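(* Let $p$ be an odd prime, $H=\langle x,y,z\mid\text{class }2,\ \text{exponent }p\rangle$ (the free group of class $2$ and exponent $p$ on $X=\{x,y,z\}$), $n\ge1$, and $P=H\circ\cdots\circ H$ ($2n$ factors). Fix $\alpha,\beta\in\mathbb{Z}_p$ with $\omega=\alpha^2+\beta^2$ a non-square in $\mathbb{Z}_p$. For $0\le m\le n$ let $\mathcal{H}_m=\{K_1,\dots,K_{2m},H_{2m+1},\dots,H_{2n}\}$, where $H_i=\langle g_i:g\in X\rangle$, $K_{2j-1}=\langle g_{2j-1}^{\alpha}g_{2j}^{\beta}:g\in X\rangle$ and $K_{2j}=\langle g_{2j-1}^{\beta}g_{2j}^{-\alpha}:g\in X\rangle$ for $1\le j\le m$. Then: (i) every member of $\mathcal{H}_m$ is isomorphic to $H$; (ii) $\mathcal{H}_m$ is a fully refined central decomposition of $P$; (iii) for every fully refined central decomposition $\mathcal{K}$ of $P$ there is a unique $m$ and some $\alpha'\in C_{\operatorname{Aut}P}(P')$ with $\mathcal{K}\alpha'=\mathcal{H}_m$, so $C_{\operatorname{Aut}P}(P')$ has exactly $1+n$ orbits on fully refined central decompositions; (iv) $\mathcal{H}_m$ and $\mathcal{H}_{m'}$ lie in the same $\operatorname{Aut}P$-orbit if and only if $m'=m$ or $m'=n-m$. Hence $\operatorname{Aut}P$ has exactly $1+\lfloor n/2\rfloor$ orbits on the set of fully refined central decompositions of $P$.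
   Context: $H\circ\cdots\circ H$ ($r$ factors) denotes $(H\times\cdots\times H)/N$ with $N$ generated by the elements having $z$ in coordinate $i$, $z^{-1}$ in coordinate $j$ and $1$ elsewhere, for $i<j$ and $z\in Z(H)$. For $g\in H$, $g_i$ denotes the image in $P$ of the element with $g$ in coordinate $i$ and $1$ elsewhere; exponents in $\mathbb{Z}_p$ are interpreted via integer representatives. A central decomposition of $P$ is a set of subgroups, pairwise commuting elementwise, generating $P$, with no proper subset generating $P$; it is fully refined if each member has no central decomposition other than itself. $\operatorname{Aut}P$ acts by $\mathcal{K}\alpha=\{K\alpha:K\in\mathcal{K}\}$. *)

(* Defs.v *)
From HB Require Import structures.
From mathcomp Require Import all_boot all_order all_algebra all_fingroup all_solvable.
Set Implicit Arguments. Unset Strict Implicit. Unset Printing Implicit Defensive.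
Import GroupScope.
Local Open Scope group_scope.

Definition class2_expp (p : nat) (rT : finGroupType) (G : {set rT}) : Prop :=
  nilpotent G /\ nil_class G <= 2 /\ exponent G %| p.

Definition free_class2_exp (p : nat) (gT : finGroupType) (H : {group gT})
    (x y z : gT) : Prop :=
  [/\ H :=: <<[set x; y; z]>>, class2_expp p H &
      forall (rT : finGroupType) (a b c : rT),
        class2_expp p <<[set a; b; c]>> ->
        exists f : {morphism H >-> rT}, [/\ f x = a, f y = b & f z = c]].

Section CentralPower.
Variables (gT : finGroupType) (H : {group gT}) (r : nat).
Notation gTn := {dffun forall i : 'I_r, gT}.

Definition cpow_full : {group gTn} := setXn_group (fun _ : 'I_r => H).

Definition cpow_Ngens : {set gTn} :=
  \bigcup_(i : 'I_r) \bigcup_(j : 'I_r | i < j)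
      [set (@dfung1 _ (fun _ => gT) i zz) * (@dfung1 _ (fun _ => gT) j zz^-1)
         | zz in 'Z(H)].
Definition cpow_N : {group gTn} := <<cpow_Ngens>>%G.

Definition cpow : {set coset_of cpow_N} := cpow_full / cpow_N.

(* g_k : the image in P of the element with g in coordinate k and 1
   elsewhere (k is a 0-based index; out-of-range indices give 1, but
   they are never used below). *)
Definition coordg (k : nat) (g : gT) : coset_of cpow_N :=
  if insub k is Some i then coset cpow_N (@dfung1 _ (fun _ => gT) i g) else 1.
End CentralPower.

Section CentralDecomp.
Variable T : finGroupType.

Definition central_decomp (G : {set T}) (D : {set {set T}}) : bool :=
  [&& [forall K in D, group_set K],
      [forall K in D, forall L in D, (K != L) ==> (K \subset 'C(L))],
      <<cover D>> == G &
      [forall D' : {set {set T}}, (D' \proper D) ==> (<<cover D'>> != G)]].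

Definition fully_refined (G : {set T}) (D : {set {set T}}) : bool :=
  central_decomp G D &&
  [forall K in D, forall D' : {set {set T}}, central_decomp K D' ==> (D' == [set K])].

Definition fr_decomps (G : {set T}) : {set {set {set T}}} :=
  [set D | fully_refined G D].

Definition act_decomp (a : {perm T}) (D : {set {set T}}) : {set {set T}} :=
  [set (fun K : {set T} => [set a u | u in K]) K0 | K0 in D].

Definition n_fr_orbits (A : {set {perm T}}) (G : {set T}) : nat :=
  #|[set [set act_decomp a D | a in A] | D in fr_decomps G]|.

Definition autC' (G : {set T}) : {set {perm T}} :=
  [set a in Aut G | [forall u in [~: G, G], a u == u]].
End CentralDecomp.

(* Paper indices 1..2n correspond to 0-based indices 0..2n-1 here.    *)
Section Hm.
Variables (p : nat) (gT : finGroupType) (H : {group gT}) (x y z : gT).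
Variables (n : nat) (al be : 'F_p).
Local Notation r := (n.*2).
Local Notation cg := (@coordg gT H r).
Local Notation X := [set x; y; z].

(* H_i (0-based k = i - 1) *)
Definition Hcoord (k : nat) : {set coset_of (cpow_N H r)} :=
  <<[set cg k g | g in X]>>.
(* K_{2j-1}, K_{2j} for paper index j = j0 + 1 *)
Definition Kodd (j0 : nat) : {set coset_of (cpow_N H r)} :=
  <<[set cg j0.*2 g ^+ (val al) * cg j0.*2.+1 g ^+ (val be) | g in X]>>.
Definition Keven (j0 : nat) : {set coset_of (cpow_N H r)} :=
  <<[set cg j0.*2 g ^+ (val be) * (cg j0.*2.+1 g ^+ (val al))^-1 | g in X]>>.

Definition Hm (m : nat) : {set {set coset_of (cpow_N H r)}} :=
  [set Kodd j | j : 'I_m] :|: [set Keven j | j : 'I_m]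
    :|: [set Hcoord k | k : 'I_r & m.*2 <= k].
End Hm.

(* Main.v *)
Require Import Defs.
From HB Require Import structures.
From mathcomp Require Import all_boot all_order all_algebra all_fingroup all_solvable.
From mathcomp Require Import ring zify.
Set Implicit Arguments.
Unset Strict Implicit.
Unset Printing Implicit Defensive.
Import GroupScope GRing.Theory.

(* Put F = Z_p and V = F^(2n) with its dot product. The group P is the group on
   (V (x) F^3) + (exterior square of F^3) in which the commutator of v (x) e and
   w (x) f is (v.w) e ^ f. If P = K L with [K, L] = 1, the projection onto the
   image of K is self-adjoint for this pairing, hence of the form A (x) 1, so the
   image of K is U (x) F^3 for some subspace U of V. As p is odd, U contains an
   anisotropic vector v, whose line Fv (x) F^3 + centre splits off from K; hence
   fully refined central decompositions of P are orthogonal bases of V up to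
   scaling. After scaling, the norms of the basis vectors are 1 or omega, the
   number of omegas is even because the determinant of the Gram matrix is a
   square, and the orthogonal group, which acts on P centralizing P', is
   transitive on such bases with a given number of omegas. Finally, if an
   automorphism acts on P' by S and maps the line of v to the line of w by
   T : F^3 -> F^3, then (v.v) S is (w.w) times the exterior square of T, whence
   (v.v) (w.w) det S is a square. So the automorphism preserves all square classes
   of norms or changes all of them, and a similitude of factor omega realizes the
   second case. *)

(** * The Heisenberg-type model V (x) F^3 + F^3 *)

Section Dot.
Local Open Scope ring_scope.
Variables (F : fieldType) (r : nat).
Implicit Types (u v w : 'rV[F]_r) (c : F).

Definition dot u v : F := (u *m v^T) 0 0.

Lemma dotE u v : u *m v^T = (dot u v)%:M.
Proof. by apply/matrixP=> i j; rewrite !ord1 [RHS]mxE mulr1n. Qed.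

Lemma dotC u v : dot u v = dot v u.
Proof. by rewrite /dot -[u *m v^T]trmxK mxE trmx_mul trmxK. Qed.

Lemma dotDl u v w : dot (u + v) w = dot u w + dot v w.
Proof. by rewrite /dot mulmxDl mxE. Qed.

Lemma dotDr u v w : dot u (v + w) = dot u v + dot u w.
Proof. by rewrite dotC dotDl !(dotC u). Qed.

Lemma dotNl u v : dot (- u) v = - dot u v.
Proof. by rewrite /dot mulNmx mxE. Qed.

Lemma dotNr u v : dot u (- v) = - dot u v.
Proof. by rewrite dotC dotNl dotC. Qed.

Lemma dotZl c u v : dot (c *: u) v = c * dot u v.
Proof. by rewrite /dot -scalemxAl mxE. Qed.

Lemma dotZr c u v : dot u (c *: v) = c * dot u v.
Proof. by rewrite dotC dotZl dotC. Qed.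

Lemma dot0l v : dot 0 v = 0.
Proof. by rewrite /dot mul0mx mxE. Qed.

Lemma dot0r v : dot v 0 = 0.
Proof. by rewrite dotC dot0l. Qed.

Definition dot_lin := (dotDl, dotDr, dotNl, dotNr, dotZl, dotZr, dot0l, dot0r).

Lemma dot_delta u j : dot u (delta_mx 0 j) = u 0 j.
Proof. by rewrite /dot trmx_delta -colE mxE. Qed.

Lemma dot_nondeg v : (forall w, dot v w = 0) -> v = 0.
Proof. by move=> h; apply/rowP=> j; rewrite -dot_delta h mxE. Qed.

End Dot.

(** Stated for rectangular [A], so that it covers both similitudes of V and the embedding of a line,
    where [A] is a single row. *)
Lemma dot_mul (F : fieldType) r s (u v : 'rV[F]_r) (A : 'M_(r, s)) (c : F) :
  (A *m A^T = c%:M -> dot (u *m A) (v *m A) = c * dot u v)%R.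
Proof.
move=> h; rewrite {1}/dot trmx_mul mulmxA -(mulmxA u) h mul_mx_scalar.
by rewrite -scalemxAl mxE.
Qed.

Lemma dot_row1 (F : fieldType) r (s t : 'rV[F]_1) (v : 'rV[F]_r) :
  (dot (s *m v) (t *m v) = dot v v * dot s t)%R.
Proof. by apply: dot_mul; rewrite dotE. Qed.

Section Heis.
Local Open Scope ring_scope.
Variables (F : finFieldType) (r : nat).
Local Notation V := 'rV[F]_r.

(* [Heis u v w a b c] stands for u (x) e1 + v (x) e2 + w (x) e3 in V (x) F^3
   together with a e2^e3 + b e3^e1 + c e1^e2 in the exterior square of F^3. *)
Variant heis := Heis of V & V & V & F & F & F.

Lemma eq_Heis u v w a b c u' v' w' a' b' c' :
  u = u' -> v = v' -> w = w' -> a = a' -> b = b' -> c = c' ->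
  Heis u v w a b c = Heis u' v' w' a' b' c'.
Proof. by do 6!move=> ->. Qed.

Definition heis_enc q := let: Heis u v w a b c := q in (u, v, w, (a, b, c)).
Definition heis_dec q := let: (u, v, w, (a, b, c)) := q in Heis u v w a b c.
Lemma heis_encK : cancel heis_enc heis_dec. Proof. by case. Qed.
HB.instance Definition _ := Finite.copy heis (can_type heis_encK).

Definition cross1 q q' :=
  let: Heis u v w _ _ _ := q in let: Heis u' v' w' _ _ _ := q' in
  dot v w' - dot w v'.
Definition cross2 q q' :=
  let: Heis u v w _ _ _ := q in let: Heis u' v' w' _ _ _ := q' in
  dot w u' - dot u w'.
Definition cross3 q q' :=
  let: Heis u v w _ _ _ := q in let: Heis u' v' w' _ _ _ := q' in
  dot u v' - dot v u'.

(* The factor 1/2 makes powers linear: [q ^+ k] is [q] scaled by [k]. *)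
Definition heis_mul q q' :=
  let: Heis u v w a b c := q in let: Heis u' v' w' a' b' c' := q' in
  Heis (u + u') (v + v') (w + w') (a + a' + 2^-1 * cross1 q q')
    (b + b' + 2^-1 * cross2 q q') (c + c' + 2^-1 * cross3 q q').
Definition heis_one := Heis 0 0 0 0 0 0.
Definition heis_inv q :=
  let: Heis u v w a b c := q in Heis (- u) (- v) (- w) (- a) (- b) (- c).

Lemma heis_mulA : associative heis_mul.
Proof.
case=> u v w a b c [u' v' w' a' b' c'] [u2 v2 w2 a2 b2 c2].
apply: eq_Heis; [exact: addrA | exact: addrA | exact: addrA | | |];
  rewrite /= !dot_lin; ring.
Qed.
Lemma heis_mul1 : left_id heis_one heis_mul.
Proof. by case=> u v w a b c; apply: eq_Heis; rewrite ?add0r //= !dot_lin; ring. Qed.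
Lemma heis_mulV : left_inverse heis_one heis_inv heis_mul.
Proof.
case=> u v w a b c; apply: eq_Heis; rewrite ?addNr //= !dot_lin.
- by rewrite (dotC w v); ring.
- by rewrite (dotC w u); ring.
- by rewrite (dotC v u); ring.
Qed.
HB.instance Definition _ :=
  Finite_isGroup.Build heis heis_mulA heis_mul1 heis_mulV.

End Heis.
Arguments Heis {F r} (_ _ _ _ _ _)%_ring_scope.

Lemma Heis_inj (F : finFieldType) r (u v w u' v' w' : 'rV[F]_r) (a b c a' b' c' : F) :
  Heis u v w a b c = Heis u' v' w' a' b' c' ->
  [/\ u = u', v = v' & w = w'] /\ [/\ a = a', b = b' & c = c'].
Proof. by case=> -> -> -> -> -> ->. Qed.

(** The second clause says that [F] is a prime field: each scalar is an integer, so scaling in the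
    model is taking a power, and subgroups project to subspaces. *)
Definition odd_prime_field (F : finFieldType) : Prop :=
  (2 != 0 :> F)%R /\ forall c : F, exists n, (c = n%:R)%R.

Section HeisTheory.
Variables (F : finFieldType) (r : nat).
Hypothesis F_odd : odd_prime_field F.
Local Notation V := 'rV[F]_r.
Implicit Types (q : heis F r) (u v w : V) (a b c : F).
Let two0 := proj1 F_odd.

Lemma heis_mulE u v w a b c u' v' w' a' b' c' :
  Heis u v w a b c * Heis u' v' w' a' b' c' =
  Heis (u + u')%R (v + v')%R (w + w')%R
    (a + a' + 2^-1 * (dot v w' - dot w v'))%R
    (b + b' + 2^-1 * (dot w u' - dot u w'))%R
    (c + c' + 2^-1 * (dot u v' - dot v u'))%R.
Proof. by []. Qed.

Lemma heis_oneE : 1 = Heis 0 0 0 0 0 0 :> heis F r.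
Proof. by []. Qed.

Lemma heis_comm q q' :
  [~ q, q'] = Heis 0 0 0 (cross1 q q') (cross2 q q') (cross3 q q').
Proof.
(* Comparing q q' with q' q [q, q'] avoids inverses. The two halves of the antisymmetric term then
   add up to the full cross product. *)
apply: (mulgI (q' * q)); rewrite -commgC.
case: q q' => u v w a b c [u' v' w' a' b' c'].
rewrite !heis_mulE; apply: eq_Heis; rewrite ?addr0 1?addrC //= !dot_lin.
- by rewrite !(dotC v') !(dotC w'); field.
- by rewrite !(dotC u') !(dotC w'); field.
- by rewrite !(dotC u') !(dotC v'); field.
Qed.

Lemma heis_expE u v w a b c n :
  Heis u v w a b c ^+ n =
  Heis (n%:R *: u) (n%:R *: v) (n%:R *: w) (n%:R * a) (n%:R * b) (n%:R * c).
Proof.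
elim: n => [|n IHn]; first by rewrite expg0 heis_oneE; apply: eq_Heis; rewrite ?scale0r ?mul0r.
rewrite expgS IHn heis_mulE -[n.+1%:R%R]natr1; apply: eq_Heis;
  rewrite ?(scalerDl, scale1r) 1?[LHS]addrC // !dot_lin.
- by rewrite (dotC w v); ring.
- by rewrite (dotC w u); ring.
- by rewrite (dotC v u); ring.
Qed.

(** Rotating the three copies of V rotates the cross products in the same way, so a fact proved for
    one slot transfers to the other two by composing [phi] with [cyc]. *)
Definition cyc q := let: Heis u v w a b c := q in Heis v w u b c a.

Lemma cycM : {morph cyc : q q' / q * q'}.
Proof. by case=> u v w a b c [u' v' w' a' b' c']. Qed.

Lemma cycI : injective cyc.
Proof. by case=> u v w a b c [u' v' w' a' b' c'] [] -> -> -> -> -> ->. Qed.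

End HeisTheory.

(** An isomorphism from the model onto [G], kept as a plain function onto a plain set so that it
    applies to quotient sets such as [cpow] and to [line]. *)
Definition coordinates (F : finFieldType) r (T : finGroupType) (G : {set T})
    (phi : heis F r -> T) :=
  [/\ {morph phi : q q' / q * q'}, injective phi & phi @: setT = G].

(** The image of [K] in V (x) F^3, with the exterior-square components forgotten. *)
Definition proj_mem (F : finFieldType) r (T : finGroupType) (phi : heis F r -> T) (K : {set T})
    u v w := exists a b c, phi (Heis u v w a b c) \in K.

Section Coordinates.
Variables (F : finFieldType) (r : nat) (T : finGroupType) (G : {set T}).
Hypothesis F_odd : odd_prime_field F.
Local Notation V := 'rV[F]_r.
Implicit Types (K L : {group T}) (u v w : V) (phi : heis F r -> T).

Lemma coord_mem phi q : coordinates G phi -> phi q \in G.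
Proof. by case=> _ _ <-; apply: imset_f. Qed.

Lemma coordP phi t : coordinates G phi -> t \in G -> exists q, t = phi q.
Proof. by case=> _ _ <- /imsetP[q _ ->]; exists q. Qed.

Lemma coord1 phi : coordinates G phi -> phi 1 = 1.
Proof. by case=> phiM _ _; apply: (mulgI (phi 1)); rewrite -phiM !mulg1. Qed.

Lemma coordV phi q : coordinates G phi -> phi q^-1 = (phi q)^-1.
Proof.
move=> co; apply: (mulgI (phi q)); case: (co) => phiM _ _.
by rewrite -phiM !mulgV coord1.
Qed.

Lemma coordX phi q n : coordinates G phi -> phi (q ^+ n) = phi q ^+ n.
Proof.
move=> co; elim: n => [|n IHn]; first by rewrite coord1.
by case: (co) => phiM _ _; rewrite !expgS phiM IHn.
Qed.

Lemma coordR phi q q' : coordinates G phi -> phi [~ q, q'] = [~ phi q, phi q'].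
Proof.
move=> co; case: (co) => phiM _ _.
by rewrite /commg /conjg !phiM !coordV.
Qed.

Lemma coord_cyc phi : coordinates G phi -> coordinates G (phi \o @cyc F r).
Proof.
case=> phiM phiI phiG; split.
- by move=> q q'; rewrite /= cycM phiM.
- exact: inj_comp phiI (@cycI F r).
- rewrite imset_comp -phiG; have -> // : @cyc F r @: setT = setT.
  by apply/setP=> -[u v w a b c]; rewrite inE; apply/imsetP; exists (Heis w u v c a b).
Qed.

Lemma coord_scale phi K u v w a b c k : coordinates G phi ->
  phi (Heis u v w a b c) \in K ->
  phi (Heis (k *: u) (k *: v) (k *: w) (k * a) (k * b) (k * c))%R \in K.
Proof.
move=> co h; have [n ->] := proj2 F_odd k; rewrite -heis_expE coordX //; exact: groupX.
Qed.

Lemma proj_memD phi K u v w u' v' w' : coordinates G phi ->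
  proj_mem phi K u v w -> proj_mem phi K u' v' w' ->
  proj_mem phi K (u + u')%R (v + v')%R (w + w')%R.
Proof.
move=> [phiM _ _] [a [b [c h]]] [a' [b' [c' h']]].
by have := groupM h h'; rewrite -phiM heis_mulE => h2; do 3!eexists; apply: h2.
Qed.

Lemma proj_memZ phi K u v w k : coordinates G phi ->
  proj_mem phi K u v w -> proj_mem phi K (k *: u)%R (k *: v)%R (k *: w)%R.
Proof.
by move=> co [a [b [c /(coord_scale k co) h]]]; do 3!eexists; apply: h.
Qed.

Lemma proj_mem_sum phi K n (u v w : 'I_n -> V) : coordinates G phi ->
  (forall i, proj_mem phi K (u i) (v i) (w i)) ->
  proj_mem phi K (\sum_i u i)%R (\sum_i v i)%R (\sum_i w i)%R.
Proof.
move=> co KU; elim/big_rec3: _ => [|i s t x _]; last exact: proj_memD.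
by exists 0%R, 0%R, 0%R; rewrite -heis_oneE (coord1 co).
Qed.

Lemma proj_mem_cyc phi K u v w :
  proj_mem (phi \o @cyc F r) K u v w <-> proj_mem phi K v w u.
Proof.
by split=> -[a [b [c h]]]; [exists b, c, a | exists c, a, b].
Qed.

Lemma coord_commute phi q q' : coordinates G phi -> commute (phi q) (phi q') ->
  [/\ cross1 q q' = 0, cross2 q q' = 0 & cross3 q q' = 0]%R.
Proof.
move=> co /commgP /eqP; rewrite -coordR // -(coord1 co) heis_comm //.
by case: co => _ phiI _ /phiI[].
Qed.

(** The components [a], [b], [c] do not enter a commutator, so elementwise commutation is a
    condition on projections alone: the three components of the pairing vanish. *)
Lemma proj_mem_orth phi K L u v w u' v' w' : coordinates G phi ->
  L \subset 'C(K) -> proj_mem phi K u v w -> proj_mem phi L u' v' w' ->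
  [/\ dot v w' = dot w v', dot w u' = dot u w' & dot u v' = dot v u'].
Proof.
move=> co cKL [a [b [c h]]] [a' [b' [c' h']]].
have /(coord_commute co)[] := centsP cKL _ h' _ h.
by move=> /= /subr0_eq h1 /subr0_eq h2 /subr0_eq h3; split; rewrite dotC -?h1 -?h2 -?h3 dotC.
Qed.

End Coordinates.

(** * Central factors and the three slots *)

Section CentralFactors.
Variables (F : finFieldType) (r : nat) (T : finGroupType) (G : {set T}) (K L : {group T}).
Hypothesis F_odd : odd_prime_field F.
Hypotheses (defG : K * L = G) (cKL : L \subset 'C(K)).
Local Notation V := 'rV[F]_r.
Implicit Types (u v w : V) (phi : heis F r -> T).
Let two0 := proj1 F_odd.

Lemma proj_split phi u v w : coordinates G phi ->
  exists u1 v1 w1, proj_mem phi K u1 v1 w1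
    /\ proj_mem phi L (u - u1)%R (v - v1)%R (w - w1)%R.
Proof.
move=> co; have /mulsgP[k l Kk Ll klE] : phi (Heis u v w 0 0 0) \in K * L.
  by rewrite defG coord_mem.
have Gk : k \in G by rewrite -defG (subsetP (mulG_subl _ _)).
have Gl : l \in G by rewrite -defG (subsetP (mulG_subr _ _)).
have [[u1 v1 w1 a1 b1 c1] kE] := coordP co Gk.
have [[u2 v2 w2 a2 b2 c2] lE] := coordP co Gl.
case: (co) => phiM phiI _; move: klE Kk Ll.
rewrite kE lE -phiM heis_mulE => /phiI[-> -> -> _ _ _] Kk Ll.
exists u1, v1, w1; split; first by exists a1, b1, c1.
by exists a2, b2, c2; rewrite !(addrC _ u2, addrC _ v2, addrC _ w2) !addrK.
Qed.

(* The projection onto the first factor is self-adjoint for the commutator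
   pairing, which forces it to preserve the three copies of V. *)
Lemma proj_split_slot phi v : coordinates G phi ->
  exists v1, proj_mem phi K v1 0%R 0%R /\ proj_mem phi L (v - v1)%R 0%R 0%R.
Proof.
move=> co; have [u1 [v1 [w1 [KX LX]]]] := proj_split v 0%R 0%R co.
(* Pair [w1] with any [w] put in the second slot and split in turn between [K] and [L]. Commutation
   of each [K] part with the other [L] part gives two relations whose combination is w1.w = 0. For
   [v1] below, [w] goes in the third slot. *)
have w10 : w1 = 0%R.
  apply: dot_nondeg => w.
  have [y1 [y2 [y3 [KY LY]]]] := proj_split 0%R w 0%R co.
  have [h1 _ _] := proj_mem_orth F_odd co cKL KX LY.
  have [h2 _ _] := proj_mem_orth F_odd co cKL KY LX.
  move: h1 h2; rewrite !dot_lin !(dotC _ v1) !(dotC _ w1) => h1 h2.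
  transitivity ((dot w1 w + - dot w1 y2 - (0 - dot v1 y3))
                + ((0 - dot v1 y3) - (0 - dot w1 y2)))%R; first by ring.
  by rewrite -h1 h2; ring.
have v10 : v1 = 0%R.
  apply: dot_nondeg => w.
  have [y1 [y2 [y3 [KY LY]]]] := proj_split 0%R 0%R w co.
  have [h1 _ _] := proj_mem_orth F_odd co cKL KX LY.
  have [h2 _ _] := proj_mem_orth F_odd co cKL KY LX.
  move: h1 h2; rewrite !dot_lin !(dotC _ v1) !(dotC _ w1) => h1 h2.
  transitivity ((dot v1 w + - dot v1 y3 - (0 - dot w1 y2))
                + ((0 - dot w1 y2) - (0 - dot v1 y3)))%R; first by ring.
  by rewrite h1 h2; ring.
by exists u1; move: KX LX; rewrite v10 w10 subr0.
Qed.

Lemma proj_split_slot2 phi v : coordinates G phi ->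
  exists v1, proj_mem phi K 0%R v1 0%R /\ proj_mem phi L 0%R (v - v1)%R 0%R.
Proof.
move=> co; have [v1 []] := proj_split_slot v (coord_cyc (coord_cyc co)).
by move=> /proj_mem_cyc/proj_mem_cyc ? /proj_mem_cyc/proj_mem_cyc ?; exists v1.
Qed.

Lemma proj_split_slot3 phi v : coordinates G phi ->
  exists v1, proj_mem phi K 0%R 0%R v1 /\ proj_mem phi L 0%R 0%R (v - v1)%R.
Proof.
move=> co; have [v1 []] := proj_split_slot v (coord_cyc co).
by move=> /proj_mem_cyc ? /proj_mem_cyc ?; exists v1.
Qed.

(** Let [x] be the [K] part of [u] in the first slot. Then u - x is orthogonal to the [K] part of
    any [z], because it lies in the projection of [L], and to the [L] part of [z], because [u] and
    [x] both come from [K]. *)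
Lemma proj_mem_slot phi u v w : coordinates G phi ->
  proj_mem phi K u v w -> proj_mem phi K u 0%R 0%R.
Proof.
move=> co KU; have [x [Kx Lx]] := proj_split_slot u co.
suff -> : u = x by [].
apply/subr0_eq; apply: dot_nondeg => z.
have [y [Ky Ly]] := proj_split_slot2 z co.
have [_ _ h1] := proj_mem_orth F_odd co cKL Ky Lx.
have [_ _ h2] := proj_mem_orth F_odd co cKL KU Ly.
have [_ _ h3] := proj_mem_orth F_odd co cKL Kx Ly.
move: h1 h2 h3; rewrite !dot_lin !(dotC _ u) !(dotC _ x) => h1 h2 h3.
transitivity ((dot u y - dot x y) + (dot u z - dot u y)
              - (dot x z - dot x y))%R; first by ring.
by rewrite -h1 h2 h3; ring.
Qed.

(** The same orthogonality argument with test vectors in the third slot. Combined with rotations, it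
    shows that all three slots of [K] carry one and the same subspace U of V. *)
Lemma proj_mem_slot12 phi v : coordinates G phi ->
  proj_mem phi K v 0%R 0%R -> proj_mem phi K 0%R v 0%R.
Proof.
move=> co Kv; have [y [Ky Ly]] := proj_split_slot2 v co.
suff -> : v = y by [].
apply/subr0_eq; apply: dot_nondeg => w.
have [z [Kz Lz]] := proj_split_slot3 w co.
have [h1 _ _] := proj_mem_orth F_odd co cKL Kz Ly.
have [_ h2 _] := proj_mem_orth F_odd co cKL Kv Lz.
have [h3 _ _] := proj_mem_orth F_odd co cKL Ky Lz.
move: h1 h2 h3; rewrite !dot_lin !(dotC _ v) !(dotC _ y) => h1 h2 h3.
transitivity ((dot v z - dot y z) + (dot v w - dot v z)
              - (dot y w - dot y z))%R; first by ring.
by rewrite -h1 -h2 h3; ring.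
Qed.

(** U is nonzero and the form on it is nondegenerate, so U contains two vectors with nonzero
    product; if both are isotropic, their sum is anisotropic because 2 is invertible. *)
Lemma anisotropic_slots phi u v w a b c : coordinates G phi ->
  phi (Heis u v w a b c) \in K -> [|| u != 0, v != 0 | w != 0]%R ->
  exists2 x, dot x x != 0%R &
    [/\ proj_mem phi K x 0%R 0%R, proj_mem phi K 0%R x 0%R
      & proj_mem phi K 0%R 0%R x].
Proof.
move=> co Kq nz.
have co' := coord_cyc co; have co2 := coord_cyc co'.
have KU : proj_mem phi K u v w by exists a, b, c.
have s12 x : proj_mem phi K x 0%R 0%R -> proj_mem phi K 0%R x 0%R.
  exact: proj_mem_slot12.
have s31 x : proj_mem phi K 0%R 0%R x -> proj_mem phi K x 0%R 0%R.
  by move=> /(proj_mem_cyc phi) /(proj_mem_slot12 co') /proj_mem_cyc.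
have s23 x : proj_mem phi K 0%R x 0%R -> proj_mem phi K 0%R 0%R x.
  by move=> /(proj_mem_cyc phi)/(proj_mem_cyc (phi \o @cyc F r)) /(proj_mem_slot12 co2) /proj_mem_cyc/proj_mem_cyc.
suff [x xx Kx] : exists2 x, dot x x != 0%R & proj_mem phi K x 0%R 0%R.
  by exists x => //; split; [| apply: s12 | apply/s23/s12].
have [x x0 Kx] : exists2 x, x != 0%R & proj_mem phi K x 0%R 0%R.
  case/or3P: nz => nz.
  - by exists u => //; apply: proj_mem_slot KU.
  - exists v => //; apply/s31/s23.
    move: KU => /(proj_mem_cyc phi)/(proj_mem_cyc (phi \o @cyc F r)).
    move=> /(proj_mem_slot co2).
    by move=> /proj_mem_cyc/proj_mem_cyc.
  - exists w => //; apply/s31.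
    by move: KU => /(proj_mem_cyc phi) /(proj_mem_slot co') /proj_mem_cyc.
have [z xz] : exists z, dot x z != 0%R.
  case: (pickP (fun z => dot x z != 0%R)) => [z|h]; first by exists z.
  by case/eqP: x0; apply: dot_nondeg => z; apply/eqP/negbFE/h.
(* The [L] part of [z] is orthogonal to [x], so its [K] part [y] still satisfies x.y = x.z, which is
   nonzero. *)
have [y [Ky Ly]] := proj_split_slot2 z co.
have [_ _ h] := proj_mem_orth F_odd co cKL Kx Ly.
move: h; rewrite !dot_lin => /subr0_eq h.
move: xz; rewrite h => xy.
have [xx|] := eqVneq (dot x x) 0%R; last by exists x.
have {}Ky := s31 _ (s23 _ Ky).
have [yy|] := eqVneq (dot y y) 0%R; last by exists y.
exists (x + y)%R; last first.
  by have := proj_memD co Kx Ky; rewrite !addr0.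
rewrite !dot_lin xx yy (dotC y) add0r addr0 -mulr2n -mulr_natl.
by rewrite mulf_neq0.
Qed.

End CentralFactors.

(** * Lines *)

(** Groups all members other than [K] into one factor, which reduces a decomposition of any size to
    a product of two commuting subgroups. *)
Lemma central_decomp_split (T : finGroupType) (G : {set T}) D (K : {group T}) :
  central_decomp G D -> (K : {set T}) \in D ->
  K * <<cover (D :\ (K : {set T}))>> = G /\ <<cover (D :\ (K : {set T}))>> \subset 'C(K).
Proof.
case/and4P=> _ cD /eqP <- _ DK.
have cKL : <<cover (D :\ (K : {set T}))>> \subset 'C(K).
  rewrite gen_subG; apply/bigcupsP=> L /setD1P[neqLK DL].
  have /'forall_implyP/(_ _ DL)/'forall_implyP/(_ _ DK) := cD.
  by move/implyP; apply.
split=> //; rewrite -cent_joinEr // joing_idr; congr <<_>>.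
by rewrite /cover [RHS](big_setD1 (K : {set T})).
Qed.

Section Lines.
Variables (F : finFieldType) (r : nat) (T : finGroupType).
Hypothesis F_odd : odd_prime_field F.
Local Notation V := 'rV[F]_r.
Implicit Types (G : {set T}) (K L : {group T}) (u v w x y : V).
Implicit Types (phi : heis F r -> T).

Lemma coord_group G phi : coordinates G phi -> group_set G.
Proof.
move=> co; apply/group_setP; split; first by rewrite -(coord1 co) (coord_mem _ co).
move=> s t /(coordP co)[q ->] /(coordP co)[q' ->]; case: (co) => phiM _ _.
by rewrite -phiM (coord_mem _ co).
Qed.

Lemma commute_coord G phi q q' : coordinates G phi ->
  cross1 q q' = 0%R -> cross2 q q' = 0%R -> cross3 q q' = 0%R ->
  commute (phi q) (phi q').
Proof.
move=> co h1 h2 h3; apply/commgP; rewrite -(coordR _ _ co) heis_comm // h1 h2 h3.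
by rewrite -(coord1 co).
Qed.

(** Commutators of the three copies of [x] are x.x times the basis vectors of the exterior square,
    and x.x can be divided out by taking powers. *)
Lemma slots_center_sub G phi K x : coordinates G phi -> dot x x != 0%R ->
  proj_mem phi K x 0%R 0%R -> proj_mem phi K 0%R x 0%R ->
  proj_mem phi K 0%R 0%R x -> forall a b c, phi (Heis 0 0 0 a b c) \in K.
Proof.
move=> co xx [a1 [b1 [c1 K1]]] [a2 [b2 [c2 K2]]] [a3 [b3 [c3 K3]]] a b c.
have := groupR K2 K3; rewrite -(coordR _ _ co) heis_comm //= !dot_lin.
move/(coord_scale F_odd (a / dot x x)%R co) => Ka.
have := groupR K3 K1; rewrite -(coordR _ _ co) heis_comm //= !dot_lin.
move/(coord_scale F_odd (b / dot x x)%R co) => Kb.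
have := groupR K1 K2; rewrite -(coordR _ _ co) heis_comm //= !dot_lin.
move/(coord_scale F_odd (c / dot x x)%R co) => Kc.
have := groupM (groupM Ka Kb) Kc; case: (co) => phiM _ _.
rewrite -!phiM !heis_mulE !dot_lin !(subr0, oppr0, mulr0, addr0, add0r, scaler0).
by rewrite !mulfVK.
Qed.

Lemma mem_center_sub G phi K u v w a b c : coordinates G phi ->
  (forall a b c, phi (Heis 0 0 0 a b c) \in K) -> proj_mem phi K u v w ->
  phi (Heis u v w a b c) \in K.
Proof.
move=> co Z [a' [b' [c' K']]].
have := groupM K' (Z (a - a') (b - b') (c - c'))%R; case: (co) => phiM _ _.
by rewrite -phiM heis_mulE !dot_lin !subr0 !(mulr0, addr0) !(addrC _ (_ - _)%R) !subrK.
Qed.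

(** Since s x and t x pair to (x.x) s t, the last three coordinates must be multiplied by x.x for
    this embedding of the one-dimensional model to be a morphism. *)
Definition line_coord x (m : heis F 1) : heis F r :=
  let: Heis s t w a b c := m in
  Heis (s *m x)%R (t *m x)%R (w *m x)%R
    (dot x x * a)%R (dot x x * b)%R (dot x x * c)%R.

Definition line phi x : {set T} := (phi \o line_coord x) @: setT.

Lemma line_coordinates G phi x : coordinates G phi -> dot x x != 0%R ->
  coordinates (line phi x) (phi \o line_coord x).
Proof.
move=> [phiM phiI _] xx; split.
- case=> s t w a b c [s' t' w' a' b' c'].
  rewrite /= -phiM !heis_mulE /= !mulmxDl !dot_row1.
  by congr (phi (Heis _ _ _ _ _ _)); ring.
- apply: inj_comp phiI _.
  have inj (s t : 'rV[F]_1) : (s *m x = t *m x -> s = t)%R.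
    move/(congr1 (mulmx^~ x^T)%R); rewrite -!mulmxA dotE !mul_mx_scalar.
    exact: scalerI.
  have injc (a b : F) : (dot x x * a = dot x x * b -> a = b)%R.
    exact: mulfI.
  case=> s t w a b c [s' t' w' a' b' c'] /Heis_inj[].
  by move=> [/inj-> /inj-> /inj->] [/injc-> /injc-> /injc->].
- by [].
Qed.

Lemma mem_line phi x s1 s2 s3 a b c : dot x x != 0%R ->
  phi (Heis (s1 *: x) (s2 *: x) (s3 *: x) a b c) \in line phi x.
Proof.
move=> xx; apply/imsetP.
exists (Heis s1%:M s2%:M s3%:M (a / dot x x) (b / dot x x) (c / dot x x))%R => //.
by rewrite /= !mul_scalar_mx !(mulrC (dot x x)) !mulfVK.
Qed.

Lemma lineP phi x t : t \in line phi x ->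
  exists s1 s2 s3 a b c, t = phi (Heis (s1 *: x) (s2 *: x) (s3 *: x) a b c).
Proof.
case/imsetP=> -[s1 s2 s3 a b c] _ -> /=.
rewrite (mx11_scalar s1) (mx11_scalar s2) (mx11_scalar s3) !mul_scalar_mx.
by do 6!eexists.
Qed.

Lemma line_sub G phi K x : coordinates G phi -> dot x x != 0%R ->
  proj_mem phi K x 0%R 0%R -> proj_mem phi K 0%R x 0%R ->
  proj_mem phi K 0%R 0%R x -> line phi x \subset K.
Proof.
move=> co xx K1 K2 K3; apply/subsetP=> _ /lineP[s1 [s2 [s3 [a [b [c ->]]]]]].
apply: (mem_center_sub _ _ _ co); first exact: slots_center_sub co xx K1 K2 K3.
have := proj_memD co (proj_memD co (proj_memZ F_odd s1 co K1) (proj_memZ F_odd s2 co K2))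
  (proj_memZ F_odd s3 co K3).
by rewrite !scaler0 !(addr0, add0r).
Qed.

Lemma line_slots phi x : dot x x != 0%R ->
  [/\ phi (Heis x 0 0 0 0 0) \in line phi x, phi (Heis 0 x 0 0 0 0) \in line phi x
    & phi (Heis 0 0 x 0 0 0) \in line phi x].
Proof.
move=> xx; split.
- by have := mem_line phi 1%R 0%R 0%R 0%R 0%R 0%R xx; rewrite !scale0r scale1r.
- by have := mem_line phi 0%R 1%R 0%R 0%R 0%R 0%R xx; rewrite !scale0r scale1r.
- by have := mem_line phi 0%R 0%R 1%R 0%R 0%R 0%R xx; rewrite !scale0r scale1r.
Qed.

Lemma line_nonabelian G phi x : coordinates G phi -> dot x x != 0%R ->
  ~~ (line phi x \subset 'C(line phi x)).
Proof.
move=> co xx; apply: (contra _ xx) => /centsP cxx.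
have [l1 l2 _] := line_slots phi xx.
have [_ _] := coord_commute F_odd co (cxx _ l1 _ l2).
by rewrite /= !dot_lin subr0 => ->.
Qed.

Lemma line_orth G phi x y : coordinates G phi -> dot x y = 0%R ->
  line phi x \subset 'C(line phi y).
Proof.
move=> co xy; apply/centsP=> _ /lineP[s1 [s2 [s3 [a [b [c ->]]]]]].
move=> _ /lineP[s1' [s2' [s3' [a' [b' [c' ->]]]]]].
by apply: (commute_coord co); rewrite /= !dot_lin xy !mulr0 subrr.
Qed.

(** If [K] projected to zero, the other members would project onto everything, hence contain the
    centre by commutators and generate [G] without [K], against irredundance. *)
Lemma central_decomp_noncentral G phi D K : coordinates G phi -> 0 < r ->
  central_decomp G D -> (K : {set T}) \in D ->
  exists u v w a b c,
    phi (Heis u v w a b c) \in K /\ [|| u != 0, v != 0 | w != 0]%R.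
Proof.
move=> co r_gt0 decD DK; have [defG cKL] := central_decomp_split decD DK.
case: (pickP (fun q : heis F r => (phi q \in K) &&
    let: Heis u v w _ _ _ := q in [|| u != 0, v != 0 | w != 0]%R)).
  by case=> u v w a b c /andP[Kq nz]; exists u, v, w, a, b, c.
move=> cK; pose L := <<cover (D :\ (K : {set T}))>>%G.
have LU u v w : proj_mem phi L u v w.
  have [u1 [v1 [w1 [[a [b [c KU]]] ]]]] := @proj_split _ _ _ _ K L defG _ u v w co.
  have := cK (Heis u1 v1 w1 a b c); rewrite KU /=.
  by move/norP=> [/negPn/eqP-> /norP[/negPn/eqP-> /negPn/eqP->]]; rewrite !subr0.
pose x : V := delta_mx 0%R (Ordinal r_gt0).
have xx : dot x x != 0%R by rewrite dot_delta mxE !eqxx oner_eq0.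
have LG : G = L.
  apply/eqP; rewrite eqEsubset -{2}defG mulG_subr andbT.
  apply/subsetP=> _ /(coordP co)[[u v w a b c] ->].
  apply: (mem_center_sub _ _ _ co); last exact: LU.
  exact: (slots_center_sub co xx).
case/and4P: decD => _ _ _ /forallP/(_ (D :\ (K : {set T}))).
by rewrite properD1 // implyTb -[X in X != _]LG eqxx.
Qed.

End Lines.

Lemma central_decomp_group (T : finGroupType) (G : {set T}) D (K : {set T}) :
  central_decomp G D -> K \in D -> group_set K.
Proof. by case/and4P=> /'forall_implyP h _ _ _ /h. Qed.

Lemma central_decomp_pair (T : finGroupType) (G A B : {group T}) :
  <<A :|: B>> = G -> A \subset 'C(B) -> A :!=: G -> B :!=: G ->
  central_decomp G [set (A : {set T}); (B : {set T})].
Proof.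
move=> defG cAB nA nB; apply/and4P; split.
- by apply/'forall_implyP=> K /set2P[] ->; apply: groupP.
- apply/'forall_implyP=> K /set2P[] ->; apply/'forall_implyP=> L /set2P[] ->;
    by rewrite ?eqxx //; apply/implyP=> _; rewrite // centsC.
- by rewrite /cover bigcup_setU !big_set1 defG.
apply/forallP=> D'; apply/implyP=> /properP[sD' [K]].
have sub (M N : {group T}) : D' \subset [set (M : {set T}); (N : {set T})] ->
    (M : {set T}) \notin D' -> N :!=: G -> N \subset G -> <<cover D'>> != G.
  move=> sD MD nN sN; apply: contra nN => /eqP defD; rewrite eqEsubset sN /= -defD.
  rewrite gen_subG; apply/bigcupsP=> L DL; case/set2P: (subsetP sD _ DL) => [EL|-> //].
  by rewrite -EL DL in MD.
case/set2P=> -> KD.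
- by apply: (sub A B) => //; rewrite -defG -gen_subG genS ?subsetUr ?genGid.
- by apply: (sub B A) => //; rewrite 1?setUC // -defG -gen_subG genS ?subsetUl.
Qed.

(** The trivial group also has the empty decomposition, hence the assumption that [G] is
    nontrivial. *)
Lemma central_decomp_set1 (T : finGroupType) (G : {set T}) D :
  central_decomp G D -> G != 1 -> (forall K, K \in D -> K = G) -> D = [set G].
Proof.
case/and4P=> _ _ /eqP defG _ nG h; apply/eqP; rewrite eqEsubset; apply/andP; split.
  by apply/subsetP=> K /h->; rewrite inE.
rewrite sub1set; have [K DK|D0] := pickP (mem D); first by rewrite -{1}(h K).
case/eqP: nG; rewrite -defG; have -> : D = set0 by apply/setP=> K; rewrite inE; exact: D0.
by rewrite /cover big_set0 gen0.
Qed.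

(** * Members of fully refined decompositions are lines, and lines are indecomposable *)

Section FullyRefined.
Variables (F : finFieldType) (r : nat) (T : finGroupType).
Hypothesis F_odd : odd_prime_field F.
Local Notation V := 'rV[F]_r.
Implicit Types (G : {set T}) (K L : {group T}) (u v w x y : V).
Implicit Types (phi : heis F r -> T).

Lemma central_decomp_anisotropic G phi D K : coordinates G phi -> 0 < r ->
  central_decomp G D -> (K : {set T}) \in D ->
  exists2 x, dot x x != 0%R & [/\ proj_mem phi K x 0%R 0%R,
    proj_mem phi K 0%R x 0%R & proj_mem phi K 0%R 0%R x].
Proof.
move=> co r_gt0 decD DK; have [defG cKL] := central_decomp_split decD DK.
have [u [v [w [a [b [c [Kq nz]]]]]]] := central_decomp_noncentral F_odd co r_gt0 decD DK.
exact: (@anisotropic_slots _ _ _ G K <<cover (D :\ (K : {set T}))>>%G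
  F_odd defG cKL phi _ _ _ _ _ _ co Kq nz).
Qed.

(* An anisotropic vector x in the projection of K splits off: K is the central
   product of the line of x and its centralizer in K. *)
Lemma fully_refined_line G phi D (K : {set T}) : coordinates G phi -> 0 < r ->
  fully_refined G D -> K \in D -> exists2 x, dot x x != 0%R & K = line phi x.
Proof.
move=> co r_gt0 /andP[decD /'forall_implyP refD] DK.
pose K' := Group (central_decomp_group decD DK).
have [x xx [K1 K2 K3]] := @central_decomp_anisotropic _ _ _ K' co r_gt0 decD DK.
exists x => //; have sLK : line phi x \subset K' := line_sub F_odd co xx K1 K2 K3.
have co1 := line_coordinates co xx.
pose L := Group (coord_group co1).
pose C := (K' :&: 'C(L))%G.
have ctr := slots_center_sub F_odd co xx K1 K2 K3.
have defK : <<L :|: C>> = K'.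
  apply/eqP; rewrite eqEsubset gen_subG subUset sLK subsetIl /=.
  apply/subsetP=> t Kt.
  have Gt : t \in G.
    case/and4P: (decD) => _ _ /eqP <- _; rewrite mem_gen //.
    by apply/bigcupP; exists K.
  have [[u v w a b c] tE] := coordP co Gt.
  (* Coefficient of the orthogonal projection onto Fx. Dividing [t] by its projection [l] leaves an
     element orthogonal to [x] in each slot, which therefore centralizes the line. *)
  pose c1 u := (dot u x / dot x x)%R.
  pose l := phi (Heis (c1 u *: x) (c1 v *: x) (c1 w *: x) 0 0 0)%R.
  have Ll : l \in L by apply: mem_line.
  rewrite -(mulKVg l t) groupM //; first by rewrite mem_gen // inE Ll.
  rewrite mem_gen // inE; apply/orP; right; rewrite inE.
  have -> : l^-1 * t \in K' by rewrite groupM ?groupV //; apply: (subsetP sLK).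
  apply/centP=> _ /lineP[s1 [s2 [s3 [a' [b' [c' ->]]]]]].
  rewrite /l tE -(coordV _ co); case: (co) => phiM _ _; rewrite -phiM.
  by apply: (commute_coord F_odd co); rewrite /= !dot_lin /c1; field.
have cLC : L \subset 'C(C) by rewrite centsC subsetIr.
(* Otherwise the line of [x] would lie in its own centralizer. So if the line is also proper in
   [K'], the pair is a nontrivial decomposition of [K], which full refinement forbids. *)
have nC : C :!=: K'.
  apply: contra (line_nonabelian F_odd co xx) => /eqP EC.
  by apply: subset_trans sLK _; have := subsetIr K' 'C(L); rewrite [_ :&: _]EC.
have [EL|nL] := eqVneq (L : {set T}) K'; first exact: (esym EL).
have := refD _ DK => /'forall_implyP/(_ _ (central_decomp_pair defK cLC nL nC)).
by move/eqP=> E; apply/esym/set1P; rewrite -E; apply: set21.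
Qed.

End FullyRefined.

Section Indecomposable.
Variables (F : finFieldType) (r : nat) (T : finGroupType).
Hypothesis F_odd : odd_prime_field F.
Implicit Types (phi : heis F r -> T).

Lemma line_neq1 (G : {set T}) phi x : coordinates G phi -> dot x x != 0%R -> line phi x != 1.
Proof.
move=> co xx; apply: contra (line_nonabelian F_odd co xx) => /eqP->.
exact: sub1G.
Qed.

(** A line is a model of dimension one, where the anisotropic vector supplied by any member already
    spans the whole space; so each member is the whole line. *)
Lemma line_indecomposable (G : {set T}) phi x D : coordinates G phi ->
  dot x x != 0%R -> central_decomp (line phi x) D -> D = [set line phi x].
Proof.
move=> co xx decD; have co1 := line_coordinates co xx.
apply: (central_decomp_set1 decD); first exact: line_neq1 co xx.
move=> K DK; pose K' := Group (central_decomp_group decD DK).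
have [y yy [K1 K2 K3]] := @central_decomp_anisotropic _ _ _ F_odd _ _ _ K' co1 isT decD DK.
apply/eqP; rewrite eqEsubset; apply/andP; split.
  case/and4P: (decD) => _ _ /eqP <- _; apply: subset_trans (subset_gen _).
  by apply: bigcup_sup DK.
apply/subsetP=> _ /(coordP co1)[[u v w a b c] ->].
have y0 : (y 0 0 != 0)%R.
  apply: contra yy => /eqP y0; rewrite /dot mxE big_ord1 !mxE.
  by rewrite y0 mul0r.
have scal (z : 'rV[F]_1) : z = ((z 0 0 / y 0 0) *: y)%R.
  by apply/rowP=> j; rewrite !ord1 mxE mulfVK.
rewrite (scal u) (scal v) (scal w).
exact: (subsetP (line_sub F_odd co1 yy K1 K2 K3) _ (mem_line _ _ _ _ _ _ _ yy)).
Qed.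

End Indecomposable.

(** * Orthogonal bases *)

Section Gram.
Local Open Scope ring_scope.
Variables (F : fieldType) (r : nat) (omega : F).

(** Normal form for the Gram matrix of an orthogonal basis of V after scaling, with the vectors of
    norm [omega] listed first. *)
Definition gram k : 'M[F]_r := diag_mx (\row_i (if (i < k)%N then omega else 1)).

Lemma dot_row n (B : 'M[F]_(n, r)) i j : dot (row i B) (row j B) = (B *m B^T) i j.
Proof. by rewrite /dot !mxE; apply: eq_bigr => l _; rewrite !mxE. Qed.

Lemma gramE k i j :
  gram k i j = if i == j then (if (i < k)%N then omega else 1) else 0.
Proof. by rewrite !mxE; case: eqP => [->|_]; rewrite ?mulr1n ?mulr0n. Qed.

Lemma gram_unit k : omega != 0 -> gram k \in unitmx.
Proof.
move=> nz; rewrite unitmxE unitfE det_diag; apply/prodf_neq0 => i _.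
by rewrite mxE; case: ifP => _ //; apply: oner_neq0.
Qed.

Lemma gram_factor_unit k (B : 'M[F]_r) :
  omega != 0 -> B *m B^T = gram k -> B \in unitmx.
Proof.
move=> nz E; have := gram_unit k nz; rewrite -E unitmx_mul; by case/andP.
Qed.

Lemma gram_factor_neq0 k (B : 'M[F]_r) i :
  omega != 0 -> B *m B^T = gram k -> dot (row i B) (row i B) != 0.
Proof.
by move=> nz E; rewrite dot_row E gramE eqxx; case: ifP => _ //; apply: oner_neq0.
Qed.

Lemma gram_factor_orth k (B : 'M[F]_r) i j :
  B *m B^T = gram k -> i != j -> dot (row i B) (row j B) = 0.
Proof. by move=> E /negbTE nij; rewrite dot_row E gramE nij. Qed.

(** Taking determinants gives (det B)^2 = omega^k; for odd k this makes [omega] the square of det B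
    / omega^((k-1)/2). *)
Lemma gram_factor_even k (B : 'M[F]_r) : (forall u, u ^+ 2 != omega) ->
  (k <= r)%N -> B *m B^T = gram k -> ~~ odd k.
Proof.
move=> nsq le_kr /(congr1 determinant); rewrite det_mulmx det_tr det_diag.
have -> : \prod_(i < r) (\row_(i < r) (if (i < k)%N then omega else 1)) 0 i = omega ^+ k :> F.
  rewrite (eq_bigr (fun i : 'I_r => if (i < k)%N then omega else 1)) => [|i _].
    2: by rewrite mxE.
  by rewrite -big_mkcond -(big_ord_widen _ (fun=> omega)) // prodr_const card_ord.
move=> E; apply/negP=> k_odd.
have nz : omega != 0.
  by apply: contraNneq (nsq 0) => ->; rewrite expr0n.
have := nsq (\det B / omega ^+ k./2); rewrite expr_div_n expr2 E -exprM.
rewrite -{1}(odd_double_half k) k_odd exprS -muln2 mulfK ?eqxx //.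
by rewrite expf_neq0.
Qed.

End Gram.

Section LinesDecomp.
Variables (F : finFieldType) (r : nat) (T : finGroupType).
Hypotheses (F_odd : odd_prime_field F) (r_gt0 : 0 < r).
Variables (omega : F).
Hypothesis omega0 : (omega != 0)%R.
Variables (G : {set T}) (phi : heis F r -> T).
Hypothesis co : coordinates G phi.
Local Notation V := 'rV[F]_r.
Implicit Types (x y : V) (B : 'M[F]_r).

Definition lines B := [set line phi (row i B) | i : 'I_r].

Lemma line_subG x : line phi x \subset G.
Proof. by apply/subsetP=> _ /imsetP[m _ ->]; apply: (coord_mem _ co). Qed.

Lemma lines_fully_refined k B : (B *m B^T = gram r omega k)%R ->
  fully_refined G (lines B).
Proof.
move=> E; have xx i := gram_factor_neq0 i omega0 E.
have B_unit := gram_factor_unit omega0 E.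
have Bline i : line phi (row i B) \in lines B by apply: imset_f.
have cdG : {in lines B, forall K, forall L, L \in lines B -> K != L -> K \subset 'C(L)}.
  move=> _ /imsetP[i _ ->] _ /imsetP[j _ ->] neq; apply: (line_orth F_odd co).
  by apply: gram_factor_orth E _; apply: contraNneq neq => ->.
apply/andP; split; last first.
  apply/'forall_implyP=> _ /imsetP[i _ ->]; apply/'forall_implyP=> D decD.
  by apply/eqP; apply: (line_indecomposable F_odd co (xx i) decD).
apply/and4P; split.
- apply/'forall_implyP=> _ /imsetP[i _ ->].
  exact: coord_group (line_coordinates co (xx i)).
- apply/'forall_implyP=> K DK; apply/'forall_implyP=> L DL; apply/implyP.
  exact: cdG.
- pose M := <<cover (lines B)>>%G.
  have sub i : line phi (row i B) \subset M.
    by apply: subset_trans (subset_gen _); apply: bigcup_sup (Bline i).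
  have comb u : u = (\sum_i (u *m invmx B)%R 0%R i *: row i B)%R.
    by rewrite -mulmx_sum_row mulmxKV.
  have MU u v w : proj_mem phi M u v w.
    rewrite (comb u) (comb v) (comb w); apply: (proj_mem_sum co) => i.
    by exists 0%R, 0%R, 0%R; apply: (subsetP (sub i)); apply: mem_line.
  rewrite eqEsubset; apply/andP; split.
    apply: (@subset_trans _ _ (mem (Group (coord_group co)))) => //; rewrite gen_subG.
    by apply/bigcupsP=> _ /imsetP[i _ ->]; apply: line_subG.
  apply/subsetP=> _ /(coordP co)[[u v w a b c] ->].
  apply: (mem_center_sub _ _ _ co) (MU _ _ _).
  by apply: (slots_center_sub F_odd co (xx (Ordinal r_gt0))); apply: MU.
(* If the i-th line were missing, the remaining lines, all orthogonal to it, would generate [G] and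
   centralize it; but it is not abelian. *)
apply/forallP=> D; apply/implyP=> /properP[sD [_ /imsetP[i _ ->]] nD].
apply: contra (line_nonabelian F_odd co (xx i)) => /eqP EG.
apply: subset_trans (line_subG _) _; rewrite -{1}EG gen_subG.
apply/bigcupsP=> L DL; apply: cdG => //; first exact: (subsetP sD).
by apply: contraNneq nD => <-.
Qed.

Lemma line_scale x c : (c != 0 -> dot x x != 0 -> line phi (c *: x) = line phi x)%R.
Proof.
have sub (y : V) (d : F) : (d != 0 -> dot y y != 0 -> line phi (d *: y) \subset line phi y)%R.
  move=> d0 yy; apply/subsetP=> _ /lineP[s1 [s2 [s3 [a1 [a2 [a3 ->]]]]]].
  by rewrite !scalerA; apply: mem_line.
move=> c0 xx; apply/eqP; rewrite eqEsubset sub //=.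
have -> : line phi x = line phi (c^-1 *: (c *: x))%R by rewrite scalerA mulVf // scale1r.
by rewrite sub ?invr_eq0 // !dot_lin !mulf_neq0.
Qed.

End LinesDecomp.

Section DecompLines.
Variables (F : finFieldType) (r : nat) (T : finGroupType).
Hypotheses (F_odd : odd_prime_field F) (r_gt0 : 0 < r).
Variables (omega : F).
Hypothesis omega0 : (omega != 0)%R.
Hypothesis omega_sq : (forall c : F, c != 0 ->
  exists2 t, t != 0 & c = t ^+ 2 \/ c = omega * t ^+ 2)%R.
Variables (G : {set T}) (phi : heis F r -> T).
Hypothesis co : coordinates G phi.
Local Notation V := 'rV[F]_r.

Lemma line_normalized x : dot x x != 0%R ->
  exists2 y, line phi y = line phi x & dot y y = omega \/ dot y y = 1%R.
Proof.
move=> xx; have [t t0 ht] := omega_sq xx.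
exists (t^-1 *: x)%R; first by apply: (line_scale _ _ xx) => //; rewrite invr_eq0.
rewrite !dot_lin; case: ht => ->; [right | left].
- by field.
- by field.
Qed.

Lemma coord_center x : (forall t, t \in G -> commute (phi (Heis x 0 0 0 0 0)) t) -> x = 0%R.
Proof.
move=> cx; apply: dot_nondeg => w.
have [_ _] := coord_commute F_odd co (cx _ (coord_mem (Heis 0 w 0 0 0 0)%R co)).
by rewrite /= dot0l subr0.
Qed.

(** Each member is the line of a vector of norm [omega] or 1. Distinct members commute, so these
    vectors are orthogonal; a rank computation shows that there are exactly [r] of them. *)
Lemma fully_refined_lines D : fully_refined G D ->
  exists k (B : 'M[F]_r), [/\ k <= r, (B *m B^T = gram r omega k)%R & D = lines phi B].
Proof.
move=> frD; have decD := proj1 (andP frD).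
pose good K y := (line phi y == K) && ((dot y y == omega) || (dot y y == 1%R)).
(* The default 0 is never returned on a member of [D]. *)
pose f K : V := odflt 0%R [pick y | good K y].
have fP K : K \in D -> K = line phi (f K) /\ (dot (f K) (f K) = omega \/ dot (f K) (f K) = 1%R).
  move=> DK; have [x xx KE] := fully_refined_line F_odd co r_gt0 frD DK.
  have [y yE yy] := line_normalized xx.
  rewrite /f; case: pickP => [z /andP[/eqP <- /orP[]/eqP->]|/(_ y)]; try by auto.
  by rewrite /good yE KE eqxx; case: yy => ->; rewrite eqxx ?orbT.
have ff K : K \in D -> dot (f K) (f K) != 0%R.
  by case/fP=> _ [] -> //; apply: oner_neq0.
have orth K L : K \in D -> L \in D -> K != L -> dot (f K) (f L) = 0%R.
  move=> DK DL nKL; have [KE _] := fP _ DK; have [LE _] := fP _ DL.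
  have [K1 _ _] := line_slots phi (ff _ DK); have [_ L2 _] := line_slots phi (ff _ DL).
  rewrite -KE in K1; rewrite -LE in L2.
  have cKL : K \subset 'C(L).
    case/and4P: decD => _ /'forall_implyP/(_ _ DK)/'forall_implyP/(_ _ DL).
    by rewrite nKL.
  have [_ _] := coord_commute F_odd co (centsP cKL _ K1 _ L2).
  by rewrite /= dot0l subr0.
pose D1 := [set K in D | dot (f K) (f K) == omega].
(* Members of norm [omega] come first, so that an index below #|D1| means norm [omega], as in
   [gram]. *)
pose s := enum D1 ++ enum (D :\: D1).
have mem_s K : (K \in s) = (K \in D).
  by rewrite mem_cat !mem_enum !inE; case: (K \in D) => //=; rewrite ?andbT orbN.
have s_uniq : uniq s.
  rewrite cat_uniq !enum_uniq andbT; apply/hasPn=> K /=.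
  by rewrite !mem_enum inE => /andP[].
have sD i : i < size s -> nth set0 s i \in D by move=> lt_i; rewrite -mem_s mem_nth.
(* The number of rows is left free, so that [size s] can be replaced by [r] once they are known to
   be equal, without casting matrices. *)
pose M n : 'M[F]_(n, r) := (\matrix_(i < n) f (nth set0 s i))%R.
have gramM : (M (size s) *m (M (size s))^T = gram _ omega #|D1|)%R.
  apply/matrixP=> i j; rewrite gramE -dot_row !rowK.
  case: eqVneq => [<-|nij]; last first.
    by apply: orth; rewrite ?sD ?nth_uniq.
  rewrite nth_cat -cardE; case: ltnP => h.
    have : nth set0 (enum D1) i \in D1 by rewrite -mem_enum mem_nth // -cardE.
    by rewrite inE => /andP[_ /eqP].
  have : nth set0 (enum (D :\: D1)) (i - #|D1|) \in D :\: D1.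
    rewrite -mem_enum mem_nth // ltn_subLR // cardE -size_cat; exact: ltn_ord.
  rewrite !inE => /andP[nD1 DK]; move: nD1; rewrite DK /=.
  by case: (fP _ DK) => _ [] -> //; rewrite eqxx.
have rank1 : \rank (M (size s)) = size s.
  apply/eqP; rewrite eqn_leq rank_leq_row /=.
  by rewrite -{1}(mxrank_unit (gram_unit (size s) #|D1| omega0)) -gramM mxrankM_maxl.
(* A vector orthogonal to all rows gives, in the first slot, an element commuting with every member
   and hence with [G]; by nondegeneracy it is zero, so the rows span V. *)
have rank2 : \rank (M (size s)) = r.
  rewrite -mxrank_tr; apply/eqP; apply: inj_row_free => x xM.
  have xf K : K \in D -> dot x (f K) = 0%R.
    rewrite -mem_s => sK; have lt_i : index K s < size s by rewrite index_mem.
    move/matrixP/(_ 0%R (Ordinal lt_i)): xM; rewrite !mxE => <-.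
    by rewrite /dot !mxE; apply: eq_bigr => j _; rewrite !mxE /= nth_index.
  apply: coord_center => t; case/and4P: (decD) => _ _ /eqP <- _ Gt.
  apply/commute_sym/cent1P.
  apply: (subsetP _ _ Gt).
  rewrite gen_subG; apply/bigcupsP=> K DK; apply/subsetP=> t'.
  have [-> _] := fP _ DK; case/lineP=> [s1 [s2 [s3 [a [b [c ->]]]]]].
  apply/cent1P; apply: (commute_coord F_odd co); rewrite /= !dot_lin ?(dotC _ x) ?xf //; ring.
have size_s : size s = r by rewrite -rank1.
have gramM' n : n = size s -> (M n *m (M n)^T = gram _ omega #|D1|)%R by move=> ->.
exists #|D1|, (M r); split; last 1 first.
- apply/setP=> K; apply/idP/imsetP => [DK|[i _ ->]].
    have lt_i : index K s < r by rewrite -size_s index_mem mem_s.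
    exists (Ordinal lt_i) => //; rewrite rowK /= nth_index ?mem_s //.
    by case: (fP _ DK).
  rewrite rowK; have DK : nth set0 s i \in D by rewrite sD ?size_s.
  by have [<- _] := fP _ DK.
- by rewrite -size_s size_cat -cardE leq_addr.
exact/gramM'/esym.
Qed.

End DecompLines.

(** * Automorphisms *)

Section Automorphisms.
Variables (F : finFieldType) (r : nat) (T : finGroupType).
Hypothesis F_odd : odd_prime_field F.
Variables (G : {set T}) (phi : heis F r -> T).
Hypothesis co : coordinates G phi.

Lemma coord_aut (g : heis F r -> heis F r) : {morph g : q q' / q * q'} ->
  injective g -> exists2 a : {perm T}, a \in Aut G & forall q, a (phi q) = phi (g q).
Proof.
move=> gM gI; have [phiM phiI _] := co.
pose psi t := odflt 1 [pick q | phi q == t].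
have psiK q : psi (phi q) = q.
  by rewrite /psi; case: pickP => [q' /eqP/phiI|/(_ q)] //; rewrite eqxx.
(* Elements of [Aut G] are permutations of the whole type that are the identity outside [G]. *)
pose f t := if t \in G then phi (g (psi t)) else t.
have fE q : f (phi q) = phi (g q) by rewrite /f (coord_mem _ co) psiK.
have fG t : (f t \in G) = (t \in G).
  by rewrite /f; case: ifP => // _; rewrite (coord_mem _ co).
have fI : injective f.
  move=> t t' E; have := fG t; rewrite E fG => tt'.
  case: (boolP (t \in G)) tt' E => Gt Gt'.
    have [q ->] := coordP co Gt; have [q' ->] := coordP co Gt'.
    by rewrite !fE => /phiI/gI ->.
  by rewrite /f Gt' (negbTE Gt).
exists (perm fI) => [|q]; last by rewrite permE fE.
rewrite inE; apply/andP; split.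
  apply/subsetP=> t; rewrite !inE permE; apply: contraR => Gt.
  by rewrite /f (negbTE Gt).
apply/morphicP=> _ _ /(coordP co)[q ->] /(coordP co)[q' ->].
by rewrite !permE -phiM !fE gM phiM.
Qed.

Lemma aut_mul (a : {perm T}) q q' : a \in Aut G -> a (phi q * phi q') = a (phi q) * a (phi q').
Proof. by move=> Aa; apply: (morphicP (Aut_morphic Aa)); apply: (coord_mem _ co). Qed.

Lemma aut_coord (a : {perm T}) q : a \in Aut G -> exists q', a (phi q) = phi q'.
Proof. by move=> Aa; apply: (coordP co); apply: (@Aut_closed _ (Group (coord_group co)) _ Aa); apply: (coord_mem _ co). Qed.

Lemma aut_comm (a : {perm T}) q q' s s' : a \in Aut G ->
  a (phi q) = phi s -> a (phi q') = phi s' ->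
  a (phi [~ q, q']) = phi [~ s, s'].
Proof.
move=> Aa E E'; have [phiM _ _] := co.
have [t Et] := aut_coord [~ q, q'] Aa.
have := aut_mul (q' * q) [~ q, q'] Aa.
rewrite -phiM -commgC [phi (q * q')]phiM [phi (q' * q)]phiM !aut_mul // E E' Et -!phiM.
by case: co => _ phiI _ /phiI; rewrite commgC => /mulgI ->.
Qed.

Lemma sub_autC' : autC' G \subset Aut G.
Proof. by apply/subsetP=> a; rewrite inE => /andP[]. Qed.

Lemma autC'_comm (a : {perm T}) q q' : a \in autC' G -> a (phi [~ q, q']) = phi [~ q, q'].
Proof.
rewrite inE => /andP[_ /forallP/(_ (phi [~ q, q']))/implyP fix_a].
by apply/eqP/fix_a; rewrite (coordR _ _ co) mem_commg ?(coord_mem _ co).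
Qed.

(** The fixed points of [a] in [G] form a group, so it is enough to fix the commutators, which
    generate the derived subgroup. *)
Lemma fix_comm_autC' (a : {perm T}) : a \in Aut G ->
  (forall q q', a (phi [~ q, q']) = phi [~ q, q']) -> a \in autC' G.
Proof.
move=> Aa fix_a; rewrite inE Aa /=; have [phiM _ _] := co.
pose C := [set t in G | a t == t].
have gC : group_set C.
  apply/group_setP; split.
    rewrite inE -(coord1 co) (coord_mem _ co) /=.
    by have := fix_a 1 1; rewrite comm1g => ->.
  move=> s t; rewrite !inE => /andP[/(coordP co)[q ->] /eqP Eq] /andP[/(coordP co)[q' ->] /eqP Eq'].
  by rewrite aut_mul // Eq Eq' -phiM (coord_mem _ co) eqxx.
apply/forallP=> t; apply/implyP=> Gt.
suff : t \in C by rewrite inE => /andP[].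
apply: (subsetP (_ : _ \subset Group gC) _ Gt); rewrite gen_subG.
apply/subsetP=> _ /imset2P[s s' /(coordP co)[q ->] /(coordP co)[q' ->] ->].
by rewrite -(coordR _ _ co) inE (coord_mem _ co) fix_a eqxx.
Qed.

(** A similitude of factor [c] multiplies every pairing by [c], so it extends by the scalar [c] on
    the exterior square. It is used with c = 1, which fixes P', and with c = [omega], which
    exchanges the norm classes. *)
Lemma similitude_aut (S : 'M[F]_r) c : (c != 0 -> S *m S^T = c%:M ->
  exists2 a : {perm T}, a \in Aut G & forall u v w x y z,
    a (phi (Heis u v w x y z)) =
    phi (Heis (u *m S) (v *m S) (w *m S) (c * x) (c * y) (c * z)))%R.
Proof.
move=> c0 SS.
pose g q := let: Heis u v w x y z := q in
  (Heis (u *m S) (v *m S) (w *m S) (c * x) (c * y) (c * z))%R : heis F r.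
have S_unit : S \in unitmx.
  have : (S *m S^T)%R \in unitmx by rewrite SS -scalemx1 unitmxZ ?unitfE // unitmx1.
  by rewrite unitmx_mul => /andP[].
have [||a Aa aE] := @coord_aut g; last by exists a.
  case=> u v w x y z [u' v' w' x' y' z']; rewrite /= !heis_mulE.
  rewrite !mulmxDl !(dot_mul _ _ SS); apply: eq_Heis => //; ring.
have inj (s t : 'rV[F]_r) : (s *m S = t *m S -> s = t)%R.
  by move/(congr1 (mulmx^~ (invmx S))%R); rewrite !mulmxK.
have injc (s t : F) : (c * s = c * t -> s = t)%R by exact: mulfI.
case=> s t w a b d [s' t' w' a' b' d'] /Heis_inj[].
by move=> [/inj-> /inj-> /inj->] [/injc-> /injc-> /injc->].
Qed.

Lemma act_lines (a : {perm T}) (S B : 'M[F]_r) c : (c != 0 -> S *m S^T = c%:M ->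
  (forall u v w x y z, a (phi (Heis u v w x y z)) =
    phi (Heis (u *m S) (v *m S) (w *m S) (c * x) (c * y) (c * z))) ->
  (forall i, dot (row i B) (row i B) != 0) ->
  act_decomp a (lines phi B) = lines phi (B *m S))%R.
Proof.
move=> c0 SS aE xx; rewrite /act_decomp /lines -imset_comp; apply: eq_imset => i /=.
rewrite row_mul; set x := row i B.
have xS : dot (x *m S)%R (x *m S)%R != 0%R.
  by rewrite (dot_mul _ _ SS); apply: mulf_neq0 c0 (xx i).
apply/setP=> t; apply/imsetP/idP.
  move=> [_ /lineP[s1 [s2 [s3 [b1 [b2 [b3 ->]]]]]] ->].
  by rewrite aE -!scalemxAl mem_line.
case/lineP=> [s1 [s2 [s3 [b1 [b2 [b3 ->]]]]]].
exists (phi (Heis (s1 *: x) (s2 *: x) (s3 *: x) (b1 / c) (b2 / c) (b3 / c)))%R.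
  exact/mem_line/xx.
by rewrite aE -!scalemxAl !(mulrC c) !mulfVK.
Qed.

(** The matrix B^-1 B' maps the rows of [B] to those of [B'], and it is orthogonal because both
    bases have the same Gram matrix. *)
Lemma lines_conjugate omega k (B B' : 'M[F]_r) : (omega != 0 ->
  B *m B^T = gram r omega k -> B' *m B'^T = gram r omega k ->
  exists2 a, a \in autC' G & act_decomp a (lines phi B) = lines phi B')%R.
Proof.
move=> nz E E'; have B_unit := gram_factor_unit nz E.
pose S := (invmx B *m B')%R.
have SS : (S *m S^T = 1%:M)%R.
  rewrite /S trmx_mul mulmxA -(mulmxA _ B') E' -E mulmxA mulVmx // mul1mx.
  by rewrite -trmx_mul mulVmx // trmx1.
have [a Aa aE] := similitude_aut (oner_neq0 F) SS.
exists a.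
  apply: fix_comm_autC' => // q q'; rewrite heis_comm // aE.
  by rewrite !mul0mx !mul1r.
rewrite (act_lines (oner_neq0 F) SS aE) ?mulKVmx // => i.
exact: gram_factor_neq0 E.
Qed.

End Automorphisms.

(** * Invariants of automorphisms *)

Lemma sum_ltn_ord r k : k <= r -> \sum_(i < r) (i < k : nat) = k.
Proof.
move=> le_kr; have : \sum_(i < k) 1%N = \sum_(i < r | i < k) 1%N := big_ord_widen r (fun=> 1%N) le_kr.
rewrite sum1_card card_ord => {2}->; rewrite [RHS]big_mkcond.
by apply: eq_bigr => i _; case: (i < k).
Qed.

Section Counting.
Variables (r k k' : nat) (g : 'I_r -> 'I_r).
Hypotheses (le_kr : k <= r) (le_kr' : k' <= r) (gI : injective g).

(** Here [g] will be the map on lines induced by an automorphism, and i < k will mean that the i-th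
    basis vector has norm [omega]. *)
Lemma count_same : (forall i : 'I_r, (i < k) = (g i < k')) -> k' = k.
Proof.
move=> h; rewrite -(sum_ltn_ord le_kr) -(sum_ltn_ord le_kr') (reindex_inj gI).
by apply: eq_bigr => i _; rewrite h.
Qed.

Lemma count_opp : (forall i : 'I_r, (i < k) = ~~ (g i < k')) -> k' = r - k.
Proof.
move=> h; suff E : k' + k = r by rewrite -E addnK.
rewrite -{1}(sum_ltn_ord le_kr) -{1}(sum_ltn_ord le_kr') (reindex_inj gI) -big_split.
under eq_bigr => i _ do rewrite h.
rewrite (eq_bigr (fun=> 1%N)) ?sum1_card ?card_ord // => i _ /=.
by case: (g i < k').
Qed.

End Counting.

(** * Determinants of order three, written out so that their identities are polynomial ones *)

Section Det3.
Local Open Scope ring_scope.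
Variable F : comRingType.

Definition det3 (a1 a2 a3 b1 b2 b3 c1 c2 c3 : F) : F :=
  a1 * (b2 * c3 - b3 * c2) + a2 * (b3 * c1 - b1 * c3) + a3 * (b1 * c2 - b2 * c1).

(** The rows on the left are b x c, c x a and a x b: the second exterior power of the matrix with
    rows a, b, c. *)
Lemma det3_cross a1 a2 a3 b1 b2 b3 c1 c2 c3 :
  det3 (b2 * c3 - b3 * c2) (b3 * c1 - b1 * c3) (b1 * c2 - b2 * c1)
       (c2 * a3 - c3 * a2) (c3 * a1 - c1 * a3) (c1 * a2 - c2 * a1)
       (a2 * b3 - a3 * b2) (a3 * b1 - a1 * b3) (a1 * b2 - a2 * b1)
  = det3 a1 a2 a3 b1 b2 b3 c1 c2 c3 ^+ 2.
Proof. by rewrite /det3; ring. Qed.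

Lemma det3_mul a1 a2 a3 b1 b2 b3 c1 c2 c3 x1 x2 x3 y1 y2 y3 z1 z2 z3 :
  det3 (a1 * x1 + a2 * y1 + a3 * z1) (a1 * x2 + a2 * y2 + a3 * z2) (a1 * x3 + a2 * y3 + a3 * z3)
       (b1 * x1 + b2 * y1 + b3 * z1) (b1 * x2 + b2 * y2 + b3 * z2) (b1 * x3 + b2 * y3 + b3 * z3)
       (c1 * x1 + c2 * y1 + c3 * z1) (c1 * x2 + c2 * y2 + c3 * z2) (c1 * x3 + c2 * y3 + c3 * z3)
  = det3 a1 a2 a3 b1 b2 b3 c1 c2 c3 * det3 x1 x2 x3 y1 y2 y3 z1 z2 z3.
Proof. by rewrite /det3; ring. Qed.

Lemma det3_scale d a1 a2 a3 b1 b2 b3 c1 c2 c3 :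
  det3 (d * a1) (d * a2) (d * a3) (d * b1) (d * b2) (d * b3) (d * c1) (d * c2) (d * c3)
  = d ^+ 3 * det3 a1 a2 a3 b1 b2 b3 c1 c2 c3.
Proof. by rewrite /det3; ring. Qed.

Lemma det3_1 : det3 1 0 0 0 1 0 0 0 1 = 1.
Proof. by rewrite /det3; ring. Qed.

End Det3.

Section Invariants.
Variables (F : finFieldType) (r : nat) (T : finGroupType).
Hypotheses (F_odd : odd_prime_field F) (r_gt0 : 0 < r).
Variables (omega : F).
Hypothesis nsq : (forall u, u ^+ 2 != omega)%R.
Hypothesis omega_sq : (forall c : F, c != 0 ->
  exists2 t, t != 0 & c = t ^+ 2 \/ c = omega * t ^+ 2)%R.
Variables (G : {set T}) (phi : heis F r -> T).
Hypothesis co : coordinates G phi.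
Implicit Types (a : {perm T}) (x y : 'rV[F]_r).

Let omega0 : (omega != 0)%R.
Proof. by apply: contraNneq (nsq 0) => ->; rewrite expr0n. Qed.

Let e : 'rV[F]_r := delta_mx 0%R (Ordinal r_gt0).
Let ee : dot e e = 1%R. Proof. by rewrite dot_delta mxE !eqxx. Qed.

Lemma comm_slots x : [/\
  [~ Heis 0 x 0 0 0 0, Heis 0 0 x 0 0 0] = Heis 0 0 0 (dot x x) 0 0,
  [~ Heis 0 0 x 0 0 0, Heis x 0 0 0 0 0] = Heis 0 0 0 0 (dot x x) 0 &
  [~ Heis x 0 0 0 0 0, Heis 0 x 0 0 0 0] = Heis 0 0 0 0 0 (dot x x)].
Proof. by split; rewrite heis_comm //= !dot_lin !subr0. Qed.

Lemma aut_expg a q q' n : a \in Aut G -> a (phi q) = phi q' -> a (phi (q ^+ n)) = phi (q' ^+ n).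
Proof.
move=> Aa E; have [phiM _ _] := co; elim: n => [|n IHn].
  by rewrite !expg0; have := aut_comm co Aa E E; rewrite !commgg.
by rewrite !expgS !phiM (aut_mul co) // E IHn.
Qed.

Lemma aut_center a : a \in Aut G -> exists s11 s12 s13 s21 s22 s23 s31 s32 s33,
  (forall x y z : F, a (phi (Heis 0 0 0 x y z)) = phi (Heis 0 0 0
    (x * s11 + y * s21 + z * s31) (x * s12 + y * s22 + z * s32)
    (x * s13 + y * s23 + z * s33)))%R.
Proof.
move=> Aa; have [phiM _ _] := co.
have [C1 C2 C3] := comm_slots e; rewrite ee in C1 C2 C3.
(* Images of commutators are commutators, hence central. Since e.e = 1, the commutators of the
   copies of [e] are the three basis vectors of the centre; linearity follows because scalars are
   integers. *)
have cent q q' : exists s1 s2 s3, a (phi [~ q, q']) = phi (Heis 0 0 0 s1 s2 s3).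
  have [s E] := aut_coord co q Aa; have [s' E'] := aut_coord co q' Aa.
  by rewrite (aut_comm co Aa E E') heis_comm //; do 3!eexists.
have [s11 [s12 [s13 S1]]] := cent (Heis 0 e 0 0 0 0)%R (Heis 0 0 e 0 0 0)%R.
have [s21 [s22 [s23 S2]]] := cent (Heis 0 0 e 0 0 0)%R (Heis e 0 0 0 0 0)%R.
have [s31 [s32 [s33 S3]]] := cent (Heis e 0 0 0 0 0)%R (Heis 0 e 0 0 0 0)%R.
rewrite C1 in S1; rewrite C2 in S2; rewrite C3 in S3.
exists s11, s12, s13, s21, s22, s23, s31, s32, s33 => x y z.
have [nx ->] := proj2 F_odd x; have [ny ->] := proj2 F_odd y.
have [nz ->] := proj2 F_odd z.
have := aut_expg nx Aa S1; have := aut_expg ny Aa S2; have := aut_expg nz Aa S3.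
rewrite !heis_expE // !scaler0 !mulr0 !mulr1 => E3 E2 E1.
have -> : Heis 0 0 0 nx%:R ny%:R nz%:R =
    Heis 0 0 0 nx%:R 0 0 * Heis 0 0 0 0 ny%:R 0 * Heis 0 0 0 0 0 nz%:R :> heis F r.
  by rewrite !heis_mulE !dot_lin !(subr0, mulr0, addr0, add0r).
rewrite phiM (aut_mul co) // -?phiM // (phiM (Heis _ _ _ _ _ _)) (aut_mul co) //.
by rewrite E1 E2 E3 -!phiM !heis_mulE !dot_lin !(subr0, mulr0, addr0, add0r).
Qed.

(* An automorphism acts on the centre by some 3 x 3 matrix S. On the lines of x
   and y it induces a map T of F^3 whose second exterior power is
   (x.x / y.y) S, and a second exterior power has square determinant. *)
Lemma aut_lines_square a : a \in Aut G -> exists2 s, s != 0%R &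
  (forall x y, dot x x != 0%R -> [set a t | t in line phi x] = line phi y ->
   exists f, dot x x * dot y y * s = f ^+ 2)%R /\
  (a \in autC' G -> s = 1%R).
Proof.
move=> Aa; have [phiM phiI _] := co.
have [s11 [s12 [s13 [s21 [s22 [s23 [s31 [s32 [s33 aS]]]]]]]]] := aut_center Aa.
exists (det3 s11 s12 s13 s21 s22 s23 s31 s32 s33).
  (* The inverse automorphism acts on the centre by an inverse matrix, so the determinant is
     nonzero. *)
  have Ab : a^-1 \in Aut G by apply: (@groupVr _ (Aut_group (Group (coord_group co)))) Aa.
  have [t11 [t12 [t13 [t21 [t22 [t23 [t31 [t32 [t33 bS]]]]]]]]] := aut_center Ab.
  have inv (x y z : F) : phi (Heis 0 0 0 x y z) = a^-1 (a (phi (Heis 0 0 0 x y z))) by rewrite permK.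
  have := inv 1%R 0%R 0%R; have := inv 0%R 1%R 0%R; have := inv 0%R 0%R 1%R.
  rewrite !aS !bS !(mul1r, mul0r, add0r, addr0).
  move=> /phiI/Heis_inj[_ [e31 e32 e33]] /phiI/Heis_inj[_ [e21 e22 e23]].
  move=> /phiI/Heis_inj[_ [e11 e12 e13]].
  have := det3_mul s11 s12 s13 s21 s22 s23 s31 s32 s33 t11 t12 t13 t21 t22 t23 t31 t32 t33.
  rewrite -e11 -e12 -e13 -e21 -e22 -e23 -e31 -e32 -e33 det3_1.
  by move=> /esym E; apply/eqP=> s0; move/eqP: E; rewrite s0 mul0r eq_sym oner_eq0.
split=> [x y xx axy|Ca].
  have [C1 C2 C3] := comm_slots x; have [l1 l2 l3] := line_slots phi xx.
  have img q : phi q \in line phi x -> exists b1 b2 b3 c1 c2 c3,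
      a (phi q) = phi (Heis (b1 *: y) (b2 *: y) (b3 *: y) c1 c2 c3)%R.
    by move=> lq; apply: lineP; rewrite -axy; apply: imset_f.
  have [a1 [a2 [a3 [? [? [? A1]]]]]] := img _ l1.
  have [b1 [b2 [b3 [? [? [? A2]]]]]] := img _ l2.
  have [c1 [c2 [c3 [? [? [? A3]]]]]] := img _ l3.
  have := aut_comm co Aa A2 A3; rewrite C1 aS heis_comm //=.
  move/phiI/Heis_inj=> [_ []]; rewrite !dot_lin !(mul0r, addr0, add0r) => E11 E12 E13.
  have := aut_comm co Aa A3 A1; rewrite C2 aS heis_comm //=.
  move/phiI/Heis_inj=> [_ []]; rewrite !dot_lin !(mul0r, addr0, add0r) => E21 E22 E23.
  have := aut_comm co Aa A1 A2; rewrite C3 aS heis_comm //=.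
  move/phiI/Heis_inj=> [_ []]; rewrite !dot_lin !(mul0r, addr0, add0r) => E31 E32 E33.
  have := det3_scale (dot x x) s11 s12 s13 s21 s22 s23 s31 s32 s33.
  rewrite E11 E12 E13 E21 E22 E23 E31 E32 E33 => E.
  (* With T the matrix on the lines, (x.x) S = (y.y) times the exterior square of T gives (x.x)^3
     det S = (y.y)^3 (det T)^2; multiplying by (y.y) / (x.x)^2 exhibits this square root. *)
  exists (dot y y ^+ 2 * det3 a1 a2 a3 b1 b2 b3 c1 c2 c3 / dot x x)%R.
  have {}E : (dot x x ^+ 3 * det3 s11 s12 s13 s21 s22 s23 s31 s32 s33 =
    dot y y ^+ 3 * det3 a1 a2 a3 b1 b2 b3 c1 c2 c3 ^+ 2)%R.
    by rewrite -E -det3_cross -det3_scale /det3; ring.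
  apply: (mulfI (expf_neq0 2 xx)).
  transitivity (dot y y * (dot x x ^+ 3 * det3 s11 s12 s13 s21 s22 s23 s31 s32 s33))%R.
    by ring.
  by rewrite E; field.
(* An element of [autC' G] fixes the three basis commutators, so its matrix on the centre is the
   identity. *)
have [C1 C2 C3] := comm_slots e; rewrite ee in C1 C2 C3.
have := autC'_comm co (Heis 0 e 0 0 0 0)%R (Heis 0 0 e 0 0 0)%R Ca.
rewrite C1 aS => /phiI/Heis_inj[_ []]; rewrite !(mul1r, mul0r, addr0) => -> -> ->.
have := autC'_comm co (Heis 0 0 e 0 0 0)%R (Heis e 0 0 0 0 0)%R Ca.
rewrite C2 aS => /phiI/Heis_inj[_ []]; rewrite !(mul1r, mul0r, addr0, add0r) => -> -> ->.
have := autC'_comm co (Heis e 0 0 0 0 0)%R (Heis 0 e 0 0 0 0)%R Ca.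
rewrite C3 aS => /phiI/Heis_inj[_ []]; rewrite !(mul1r, mul0r, add0r) => -> -> ->.
exact: det3_1.
Qed.

Lemma lines_inj k (B : 'M[F]_r) i j : (B *m B^T = gram r omega k)%R ->
  line phi (row i B) = line phi (row j B) -> i = j.
Proof.
move=> E Eij; apply/eqP; apply: contraT => nij.
case/negP: (line_nonabelian F_odd co (gram_factor_neq0 i omega0 E)).
by rewrite {2}Eij; apply: (line_orth F_odd co); apply: gram_factor_orth E nij.
Qed.

(** If [s] is a square, corresponding lines have norms in the same square class, and k' = k. If it
    is [omega] times a square, every class changes, and k' = r - k. On [autC' G] the value of [s] is
    1. *)
Lemma lines_invariant a k k' (B B' : 'M[F]_r) : k <= r -> k' <= r ->
  (B *m B^T = gram r omega k)%R -> (B' *m B'^T = gram r omega k')%R ->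
  a \in Aut G -> act_decomp a (lines phi B) = lines phi B' ->
  (k' = k \/ k' = r - k) /\ (a \in autC' G -> k' = k).
Proof.
move=> le_kr le_kr' E E' Aa aD.
have [s s0 [sq s1]] := aut_lines_square Aa.
have ex i : exists j, [set a t | t in line phi (row i B)] == line phi (row j B').
  have : [set a t | t in line phi (row i B)] \in lines phi B'.
    rewrite -aD; apply: (imset_f (fun K : {set T} => [set a u | u in K])).
    exact: imset_f.
  by case/imsetP=> j _ ->; exists j.
pose g i := xchoose (ex i).
have gE i : [set a t | t in line phi (row i B)] = line phi (row (g i) B').
  exact/eqP/(xchooseP (ex i)).
have gI : injective g.
  move=> i j gij; apply: (lines_inj E); apply: (imset_inj (@perm_inj _ a)).
  by rewrite !gE gij.
have key (i : 'I_r) : exists f, ((if (i < k)%N then omega else 1) *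
    (if (g i < k')%N then omega else 1) * s = f ^+ 2)%R.
  have [f] := sq _ _ (gram_factor_neq0 i omega0 E) (gE i).
  by rewrite !dot_row E E' !gramE !eqxx => ?; exists f.
have same f : f != 0%R -> (s = f ^+ 2)%R -> k' = k.
  move=> f0 sE; apply: (count_same le_kr le_kr' gI) => i.
  have [h] := key i; rewrite sE; case: (i < k); case: (g i < k') => //;
    rewrite !(mul1r, mulr1) => hE; case/eqP: (nsq (h / f)%R);
    by rewrite expr_div_n -hE mulfK // expf_neq0.
split=> [|/s1 sE]; last first.
  by apply: (same 1%R); rewrite ?oner_neq0 ?expr1n.
have [f f0 [sE|sE]] := omega_sq s0; first by left; apply: same sE.
right; apply: (count_opp le_kr le_kr' gI) => i.
have [h] := key i; rewrite sE; case: (i < k); case: (g i < k') => //;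
    rewrite ?(mul1r, mulr1) => hE.
(* Both norms are [omega], so omega^3 f^2 = h^2 and [omega] would be the square of h / (omega f). *)
- case/eqP: (nsq (h / (omega * f))%R); rewrite expr_div_n -hE; field.
  by rewrite omega0 f0.
- by case/eqP: (nsq (h / f)%R); rewrite expr_div_n -hE mulfK // expf_neq0.
Qed.

End Invariants.

(** * The free group and its central powers *)

Lemma odd_prime_field_Fp p : prime p -> odd p -> odd_prime_field 'F_p.
Proof.
move=> p_pr p_odd; split; last first.
  by move=> c; exists (val c); apply/esym/natr_Zp.
apply/eqP=> h2; have : nat_of_ord (2%:R : 'F_p)%R = 0%N by rewrite h2.
by rewrite val_Fp_nat //; move: p_pr p_odd; case: (p) => [|[|[|q]]].
Qed.

(** * Square classes of a finite field of odd characteristic *)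

Section Squares.
Local Open Scope ring_scope.
Variables (F : finFieldType) (omega : F).
Hypotheses (two0 : 2 != 0 :> F) (nsq : forall u : F, u ^+ 2 != omega).

(** Squaring is at most two-to-one on nonzero scalars, so squares make up at least half of them; the
    disjoint translate by [omega] is equally large, and the two fill everything. *)
Lemma square_class c : c != 0 ->
  exists2 t : F, t != 0 & c = t ^+ 2 \/ c = omega * t ^+ 2.
Proof.
have om0 : omega != 0 by apply: contraNneq (nsq 0) => ->; rewrite expr0n.
pose U := [set t : F | t != 0]; pose S := [set t ^+ 2 | t in U].
pose S' := [set omega * s | s in S].
(* One bit telling [t] from [- t], so that t^2 together with it determines [t]. *)
pose b (t : F) := (enum_rank t < enum_rank (- t))%N.
have cardU : (#|U| <= #|S| * 2)%N.
  rewrite -card_bool -cardsT -cardsX -(@card_in_imset _ _ (fun t => (t ^+ 2, b t)) U).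
    by apply: subset_leq_card; apply/subsetP=> _ /imsetP[t Ut ->]; rewrite in_setX in_setT andbT; apply: (imset_f (fun t : F => t ^+ 2)).
  move=> t t'; rewrite !inE => t0 t0' [/eqP]; rewrite eqf_sqr => /orP[/eqP //|/eqP->].
  rewrite /b opprK; case: ltngtP => // /ord_inj/enum_rank_inj E _.
  suff /eqP : 2 * t' = 0 by rewrite mulf_eq0 (negPf two0) (negPf t0').
  by rewrite mulr_natl mulr2n -{1}E addNr.
have cardS' : #|S'| = #|S| by apply: card_imset; apply: mulfI.
have SU : S :|: S' \subset U.
  apply/subsetP=> x; rewrite !inE => /orP[/imsetP[t]|/imsetP[_ /imsetP[t] h ->]].
    by rewrite inE => t0 ->; rewrite expf_neq0.
  by move: h; rewrite inE => t0 ->; rewrite mulf_neq0 ?expf_neq0.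
have disj : S :&: S' = set0.
  apply/setP=> x; rewrite !inE; apply/negP=> /andP[/imsetP[t _ ->]].
  case/imsetP=> _ /imsetP[t' Ut' ->] E; move: Ut'; rewrite inE => t0.
  by case/eqP: (nsq (t / t')); rewrite expr_div_n E mulfK ?expf_neq0.
have EU : S :|: S' = U.
  by apply/eqP; rewrite eqEcard SU cardsU disj cards0 subn0 cardS' addnn -muln2.
move=> c0; have : c \in S :|: S' by rewrite EU inE.
rewrite inE => /orP[/imsetP[t]|/imsetP[_ /imsetP[t] h ->]].
  by rewrite inE => t0 ->; exists t => //; left.
by move: h; rewrite inE => t0 ->; exists t => //; right.
Qed.

End Squares.

Section Generation.
Variables (F : finFieldType) (r : nat) (T : finGroupType).
Hypothesis F_odd : odd_prime_field F.

Lemma line_gen (G : {set T}) (phi : heis F r -> T) v : coordinates G phi -> dot v v != 0%R ->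
  <<[set phi (Heis v 0 0 0 0 0); phi (Heis 0 v 0 0 0 0); phi (Heis 0 0 v 0 0 0)]>> = line phi v.
Proof.
move=> co vv; set A := [set _; _; _]; apply/eqP; rewrite eqEsubset; apply/andP; split.
  apply: (@subset_trans _ _ (mem (Group (coord_group (line_coordinates co vv))))) => //.
  rewrite gen_subG; apply/subsetP=> t; rewrite !inE => /orP[/orP[]|] /eqP->.
  1-3: by have [] := line_slots phi vv.
by apply: (@line_sub _ _ _ F_odd G phi <<A>>%G v co vv);
  exists 0%R, 0%R, 0%R; rewrite mem_gen // !inE eqxx ?orbT.
Qed.

End Generation.

(** * The one-dimensional model is the free group of class 2 and exponent p on three generators *)

Section Heis1.
Variable p : nat.
Hypotheses (p_pr : prime p) (p_odd : odd p).
Local Notation M := (heis 'F_p 1).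
Let F_odd := odd_prime_field_Fp p_pr p_odd.
Let o : 'rV['F_p]_1 := const_mx 1%R.

Lemma coord_id : coordinates [set: M] id.
Proof. by split=> //; apply: imset_id. Qed.

Lemma heis1_gen : <<[set (Heis o 0 0 0 0 0 : M); Heis 0 o 0 0 0 0; Heis 0 0 o 0 0 0]>> = [set: M].
Proof.
have oo : dot o o = 1%R by rewrite /dot mxE big_ord1 !mxE mulr1.
rewrite (line_gen F_odd coord_id) ?oo ?oner_neq0 //.
apply/setP=> -[u v w a b c]; rewrite inE.
have E (z : 'rV['F_p]_1) : z = (z 0 0 *: o)%R.
  by apply/rowP=> j; rewrite !ord1 !mxE mulr1.
by rewrite (E u) (E v) (E w); apply: (mem_line id); rewrite oo oner_neq0.
Qed.

Lemma card_heis1 : #|[set: M]| = (p ^ 6)%N.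
Proof.
rewrite cardsT (bij_eq_card (f := @heis_enc _ 1)).
  by rewrite !card_prod !card_mx !card_Fp // !expnS !muln1 !mulnA.
by exists (@heis_dec _ 1) => [|[[[u v] w] [[a b] c]]] //; apply: heis_encK.
Qed.

Lemma heis1_class2 : class2_expp p [set: M].
Proof.
split; last split.
- by apply: (@pgroup_nil _ p); rewrite /pgroup card_heis1 pnatX pnat_id.
- rewrite nil_class2 gen_subG; apply/subsetP=> _ /imset2P[q q' _ _ ->].
  rewrite heis_comm // inE in_setT; apply/centP=> -[u v w a b c] _.
  by rewrite /commute !heis_mulE; apply: eq_Heis; rewrite ?add0r ?addr0 ?dot_lin //; ring.
apply/exponentP=> -[u v w a b c] _; rewrite heis_expE //.
by rewrite pchar_Fp_0 // !scale0r !mul0r.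
Qed.

End Heis1.

Section FreeGroup.
Variables (p : nat) (gT : finGroupType) (H : {group gT}) (x y z : gT).
Hypotheses (p_pr : prime p) (p_odd : odd p).
Hypothesis freeH : free_class2_exp p H x y z.
Local Notation M := (heis 'F_p 1).
Let F_odd := odd_prime_field_Fp p_pr p_odd.
Let o : 'rV['F_p]_1 := const_mx 1%R.

Lemma card_abelian_gen3 (T : finGroupType) (a b c : T) :
  abelian <<[set a; b; c]>> -> (forall t, t \in [set a; b; c] -> t ^+ p = 1) ->
  #|<<[set a; b; c]>>| <= p ^ 3.
Proof.
rewrite abelian_gen => cA expA.
have cyc_le t : t \in [set a; b; c] -> #|<[t]>| <= p.
  by move/expA => tp; apply: dvdn_leq; rewrite ?prime_gt0 // order_dvdn tp.
have [Aa Ab Ac] : [/\ a \in [set a; b; c], b \in [set a; b; c] & c \in [set a; b; c]].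
  by rewrite !inE !eqxx ?orbT.
have le_mul (K L : {group T}) : #|K * L| <= #|K| * #|L|.
  by rewrite mul_cardG leq_pmulr // cardG_gt0.
have cyc_cent s t : s \in [set a; b; c] -> t \in [set a; b; c] -> <[s]> \subset 'C(<[t]>).
  by move=> As At; rewrite cent_cycle cycle_subG; apply/cent1P; apply: (centsP cA).
have -> : <<[set a; b; c]>> = <[a]> <*> <[b]> <*> <[c]>.
  rewrite /cycle (joing_idl [set a]) (joing_idr [set a]) joing_idr.
  exact: (esym (joing_idl ([set a] :|: [set b]) [set c])).
rewrite (cent_joinEr (G := (<[a]> <*> <[b]>)%G)) /=; last first.
  by rewrite centsC join_subG !(centsC _ <[c]>) !cyc_cent.
apply: leq_trans (le_mul _ _) _; rewrite expnS expnSr mulnA leq_mul ?cyc_le //.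
rewrite /= cent_joinEr ?cyc_cent //; apply: leq_trans (le_mul _ _) _.
by rewrite expn1 leq_mul ?cyc_le.
Qed.

(** The commutators of the generators generate a central subgroup [C] of order at most p^3, modulo
    which the three generators commute; so the quotient also has order at most p^3. *)
Lemma card_free_le : #|H| <= p ^ 6.
Proof.
have [defH [nilH [clH /exponentP expH]] _] := freeH.
have [Hx Hy Hz] : [/\ x \in H, y \in H & z \in H].
  by rewrite defH !mem_gen // !inE eqxx ?orbT.
pose Y := [set [~ x, y]; [~ y, z]; [~ z, x]]; pose C := <<Y>>%G.
move: clH; rewrite nil_class2 => dZ.
have YZ : Y \subset 'Z(H).
  apply: subset_trans dZ; apply/subsetP=> t.
  by rewrite !inE => /orP[/orP[]|] /eqP->; rewrite mem_commg.
have CZ : C \subset 'Z(H) by rewrite gen_subG.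
have CH : C \subset H := subset_trans CZ (center_sub H).
have nCH : H \subset 'N(C) by rewrite cents_norm // centsC (subset_trans CZ) ?subsetIr.
have sXH : [set x; y; z] \subset H by rewrite defH subset_gen.
have nCX := subset_trans sXH nCH.
have cardC : #|C| <= p ^ 3.
  apply: card_abelian_gen3 => [|t Yt].
    by apply: abelianS (center_abelian H).
  by apply: expH; apply: (subsetP CH); apply: mem_gen.
have abX : abelian ([set x; y; z] / C).
  rewrite /abelian quotient_cents2 // gen_subG; apply/subsetP=> _ /imset2P[s t Xs Xt ->].
  have C1 : [~ x, y] \in C by rewrite mem_gen // !inE eqxx.
  have C2 : [~ y, z] \in C by rewrite mem_gen // !inE eqxx ?orbT.
  have C3 : [~ z, x] \in C by rewrite mem_gen // !inE eqxx ?orbT.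
  have C1' : [~ y, x] \in C by rewrite -invg_comm groupV.
  have C2' : [~ z, y] \in C by rewrite -invg_comm groupV.
  have C3' : [~ x, z] \in C by rewrite -invg_comm groupV.
  by move: Xs Xt; rewrite !inE => /orP[/orP[]|] /eqP-> /orP[/orP[]|] /eqP->; rewrite ?commgg ?group1.
have imX : [set x; y; z] / C = [set coset C x; coset C y; coset C z].
  by rewrite /quotient !morphimU !morphim_set1 ?(subsetP nCH).
have defHC : H / C = <<[set coset C x; coset C y; coset C z]>>.
  by rewrite defH quotient_gen // imX.
have cardHC : #|H / C| <= p ^ 3.
  rewrite defHC; apply: card_abelian_gen3; first by rewrite abelian_gen -imX.
  move=> t; rewrite -imX => /morphimP[s Ns Xs ->].
  by rewrite -morphX // expH ?morph1 // (subsetP sXH).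
by rewrite -(Lagrange CH) -card_quotient // (expnD p 3 3) leq_mul.
Qed.

(** The universal property gives a morphism onto the model, which has order p^6; the bound on the
    order of [H] makes it injective. *)
Lemma free_heis : exists f : {morphism H >-> M}, [/\ 'injm f, f @* H = setT,
  f x = Heis o 0 0 0 0 0, f y = Heis 0 o 0 0 0 0 & f z = Heis 0 0 o 0 0 0].
Proof.
have [defH _ univ] := freeH.
have [|f [fx fy fz]] := univ _ (Heis o 0 0 0 0 0 : M) (Heis 0 o 0 0 0 0) (Heis 0 0 o 0 0 0).
  by rewrite heis1_gen //; apply: heis1_class2.
have [Hx Hy Hz] : [/\ x \in H, y \in H & z \in H].
  by rewrite defH !mem_gen // !inE eqxx ?orbT.
have fH : f @* H = setT.
  apply/eqP; rewrite eqEsubset subsetT -heis1_gen // gen_subG.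
  apply/subsetP=> t; rewrite !inE => /orP[/orP[]|] /eqP->.
  - by rewrite -fx mem_morphim.
  - by rewrite -fy mem_morphim.
  - by rewrite -fz mem_morphim.
exists f; split=> //; rewrite -card_im_injm eqn_leq leq_morphim.
by rewrite fH card_heis1 // card_free_le.
Qed.

End FreeGroup.

(** * Coordinates on the central power *)

Section CentralPowerCoordinates.
Variables (p : nat) (gT : finGroupType) (H : {group gT}) (r : nat).
Hypotheses (p_pr : prime p) (p_odd : odd p).
Local Notation F := 'F_p.
Local Notation M := (heis F 1).
Variables (f : {morphism H >-> M}).
Hypotheses (f_inj : 'injm f) (f_surj : f @* H = setT).
Local Notation gTn := {dffun forall i : 'I_r.+1, gT}.
Local Notation dg i h := (@dfung1 _ (fun _ : 'I_r.+1 => gT) i h).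
Local Notation dgm i := (@dfung1_morphism _ (fun _ : 'I_r.+1 => gT) i).
Let F_odd := odd_prime_field_Fp p_pr p_odd.

Let hu (m : M) : F := let: Heis u _ _ _ _ _ := m in u 0%R 0%R.
Let hv (m : M) : F := let: Heis _ v _ _ _ _ := m in v 0%R 0%R.
Let hw (m : M) : F := let: Heis _ _ w _ _ _ := m in w 0%R 0%R.
Let ha (m : M) : F := let: Heis _ _ _ a _ _ := m in a.
Let hb (m : M) : F := let: Heis _ _ _ _ b _ := m in b.
Let hc (m : M) : F := let: Heis _ _ _ _ _ c := m in c.

(** The morphism inducing the coordinates: noncentral parts become the entries of the three row
    vectors, while central parts are added up. Its kernel on the full product is shown to be
    [cpow_N]. *)
Let psi (t : gTn) : heis F r.+1 := Heis
  (\row_i hu (f (t i))) (\row_i hv (f (t i))) (\row_i hw (f (t i)))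
  (\sum_i ha (f (t i))) (\sum_i hb (f (t i))) (\sum_i hc (f (t i))).

Let dot1 (s t : 'rV[F]_1) : dot s t = (s 0 0 * t 0 0)%R.
Proof. by rewrite /dot mxE big_ord1 mxE. Qed.

Let dot_rows (s t : 'I_r.+1 -> F) :
  (dot (\row_i s i) (\row_i t i) = \sum_i s i * t i)%R.
Proof. by rewrite /dot mxE; apply: eq_bigr => i _; rewrite !mxE. Qed.

Let psiM t t' : t \in cpow_full H r.+1 -> t' \in cpow_full H r.+1 ->
  psi (t * t') = psi t * psi t'.
Proof.
move=> /setXnP Ht /setXnP Ht'; rewrite /psi heis_mulE !dot_rows -!sumrB.
apply: eq_Heis.
1-3: apply/rowP=> i; rewrite !mxE mulg_ffun morphM //.
1-3: by case: (f _) (f _) => ? ? ? ? ? ? [? ? ? ? ? ?] /=; rewrite mxE.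
all: rewrite mulr_sumr -!big_split; apply: eq_bigr => i _; rewrite mulg_ffun morphM //.
all: by case: (f _) (f _) => ? ? ? ? ? ? [? ? ? ? ? ?] /=; rewrite !dot1.
Qed.

Let dg_full (i : 'I_r.+1) h : h \in H -> dg i h \in cpow_full H r.+1.
Proof. by move=> Hh; apply/setXnP=> j; rewrite ffunE; case: dfwithP. Qed.

Let psi_dg (i : 'I_r.+1) (h : gT) : psi (dg i h) = Heis
  (hu (f h) *: delta_mx 0%R i) (hv (f h) *: delta_mx 0%R i) (hw (f h) *: delta_mx 0%R i)
  (ha (f h)) (hb (f h)) (hc (f h)).
Proof.
have f1 : f 1 = Heis 0 0 0 0 0 0 by rewrite morph1.
have row (g : M -> F) : g (Heis 0 0 0 0 0 0) = 0%R ->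
    (\row_j g (f (dg i h j)) = g (f h) *: delta_mx 0%R i)%R.
  move=> g0; apply/rowP=> j; rewrite !mxE /=.
  have [->|nij] := eqVneq j i; first by rewrite dfung1_id mulr1.
  by rewrite dfung1_dflt 1?eq_sym // f1 g0 mulr0.
have sum (g : M -> F) : g (Heis 0 0 0 0 0 0) = 0%R ->
    (\sum_j g (f (dg i h j)) = g (f h))%R.
  move=> g0; rewrite (bigD1 i) //= dfung1_id big1 ?addr0 // => j nij.
  by rewrite dfung1_dflt 1?eq_sym // f1 g0.
by apply: eq_Heis; rewrite ?row ?sum //= mxE.
Qed.

Let center_f h : h \in 'Z(H) -> [/\ hu (f h) = 0, hv (f h) = 0 & hw (f h) = 0]%R.
Proof.
case/setIP=> Hh /centP cH.
have cf m : commute (f h) m.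
  have : m \in f @* H by rewrite f_surj inE.
  by case/morphimP=> h' Hh' _ ->; rewrite /commute -!morphM // cH.
have co := coord_id p.
have [_ _] := coord_commute F_odd co (cf (Heis 0 (const_mx 1) 0 0 0 0)%R).
have [_ _] := coord_commute F_odd co (cf (Heis (const_mx 1) 0 0 0 0 0)%R).
have [_] := coord_commute F_odd co (cf (Heis (const_mx 1) 0 0 0 0 0)%R).
case: (f h) => u v w a b c /=; rewrite !dot1 !mxE !(mulr0, mulr1, subr0, sub0r).
by move=> -> _ /eqP; rewrite oppr_eq0 => /eqP -> ->.
Qed.

Let psi_ker t : t \in cpow_N H r.+1 -> t \in cpow_full H r.+1 /\ psi t = 1.
Proof.
pose K := [set t in cpow_full H r.+1 | psi t == 1].
have psi1 : psi 1 = 1.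
  by apply: (mulgI (psi 1)); rewrite -psiM ?group1 // !mulg1.
have KE s : (s \in K) = (s \in cpow_full H r.+1) && (psi s == 1) by rewrite [LHS]in_set.
have gK : group_set K.
  apply/group_setP; split; first by rewrite KE group1 psi1 /=.
  move=> s s'; rewrite !KE => /andP[Hs /eqP Es] /andP[Hs' /eqP Es'].
  by rewrite groupM // psiM // Es Es' mulg1 eqxx.
move=> Nt; suff : t \in K by rewrite KE => /andP[? /eqP].
apply: (subsetP (_ : _ \subset Group gK)) Nt; rewrite gen_subG.
apply/bigcupsP=> i _; apply/bigcupsP=> j _; apply/subsetP=> _ /imsetP[h Zh ->].
have Hh := subsetP (center_sub H) _ Zh.
rewrite KE groupM ?dg_full ?groupV //= psiM ?dg_full ?groupV // !psi_dg.
have Zh' : h^-1 \in 'Z(H) by rewrite groupV.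
have [u0 v0 w0] := center_f Zh; have [u1 v1 w1] := center_f Zh'.
rewrite u0 v0 w0 u1 v1 w1 !scale0r heis_mulE !dot0r !subr0 !mulr0 !addr0 morphV //.
by case: (f h) => ? ? ? ? ? ? /=; rewrite !subrr.
Qed.

Let N_center : cpow_full H r.+1 \subset 'C(cpow_N H r.+1).
Proof.
rewrite cent_gen centsC; apply/bigcupsP=> i _; apply/bigcupsP=> j _.
apply/subsetP=> _ /imsetP[h /setIP[Hh /centP cH] ->].
apply/centP=> t /setXnP Ht; apply/ffunP=> k; rewrite !mulg_ffun !ffunE.
have cent (l : 'I_r.+1) h' : h' \in 'C(H) ->
    commute (dfwith (fun=> 1) (i := l) h' k : gT) (t k).
  by move/centP=> ch'; case: dfwithP => [|? _]; [apply: ch' | rewrite /commute mul1g mulg1].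
have Ch : h \in 'C(H) by apply/centP.
by apply: commute_sym; apply: commuteM; apply: commute_sym; apply: cent; rewrite ?groupV.
Qed.

Let N_norm : cpow_full H r.+1 \subset 'N(cpow_N H r.+1).
Proof. exact: cents_norm N_center. Qed.

Let coset_dg (i j : 'I_r.+1) (h : gT) : h \in 'Z(H) ->
  coset (cpow_N H r.+1) (dg i h) = coset (cpow_N H r.+1) (dg j h).
Proof.
have key (k l : 'I_r.+1) : (k < l)%N -> h \in 'Z(H) ->
    coset (cpow_N H r.+1) (dg k h) = coset (cpow_N H r.+1) (dg l h).
  move=> ltkl Zh; have Hh := subsetP (center_sub H) _ Zh.
  apply/rcoset_kercosetP; try by apply: (subsetP N_norm); apply: dg_full.
  rewrite mem_rcoset mem_gen //; apply/bigcupP; exists k => //.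
  apply/bigcupP; exists l => //; apply/imsetP; exists h => //.
  by rewrite (morphV (dgm l)) ?inE.
move=> Zh; case: (ltngtP i j) => [/key->|/key->|/ord_inj->] //.
Qed.

(** All coordinates of such a [t] are central, so modulo [cpow_N] they can be collected in
    coordinate 0, where their product is trivial because the sums of the central parts vanish. *)
Let ker_psi t : t \in cpow_full H r.+1 -> psi t = 1 -> coset (cpow_N H r.+1) t = 1.
Proof.
move=> Ht; have /setXnP Hti := Ht; rewrite heis_oneE => /Heis_inj.
move=> [[/rowP u0 /rowP v0 /rowP w0] [a0 b0 c0]].
have fE i : f (t i) = Heis 0 0 0 (ha (f (t i))) (hb (f (t i))) (hc (f (t i))).
  move: (u0 i) (v0 i) (w0 i); rewrite !mxE; case: (f (t i)) => u v w a b c /= u1 v1 w1.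
  by apply: eq_Heis => //; apply/rowP=> j; rewrite ord1 mxE.
have Zt i : t i \in 'Z(H).
  rewrite inE Hti; apply/centP=> h Hh; apply: (injmP f_inj); rewrite ?groupM //.
  rewrite !morphM // fE; case: (f h) => u v w a b c.
  by rewrite !heis_mulE !dot_lin !subr0 !mulr0 !addr0 !add0r; apply: eq_Heis => //; apply: addrC.
have tE : t = \prod_i dg i (t i).
  apply/ffunP=> i; rewrite prodg_ffun (big_only1 i) ?dfung1_id //.
  by move=> j ij _; rewrite dfung1_dflt.
have -> : coset (cpow_N H r.+1) t = \prod_i coset (cpow_N H r.+1) (dg i (t i)).
  by rewrite {1}tE morph_prod // => i _; apply: (subsetP N_norm); apply: dg_full.
rewrite (eq_bigr (fun i => coset (cpow_N H r.+1) (dg ord0 (t i)))) => [|i _].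
  2: exact: coset_dg.
rewrite -morph_prod => [|i _]; last by apply: (subsetP N_norm); apply: dg_full.
rewrite -(morph_prod (dgm ord0)) => [|i _]; last by rewrite inE.
suff -> : \prod_i t i = 1 by rewrite (morph1 (dgm ord0)) morph1.
apply: (injmP f_inj); rewrite ?group1 //; first by apply: group_prod.
rewrite morph1 morph_prod //.
have sumE (s : seq 'I_r.+1) : \prod_(i <- s) f (t i) = Heis 0 0 0
    (\sum_(i <- s) ha (f (t i))) (\sum_(i <- s) hb (f (t i))) (\sum_(i <- s) hc (f (t i))).
  elim: s => [|i s IHs]; first by rewrite !big_nil.
  by rewrite !big_cons IHs {1}fE heis_mulE !dot_lin !subr0 !mulr0 !addr0.
by rewrite sumE a0 b0 c0.
Qed.

Lemma cpow_coordinates : exists phi : heis F r.+1 -> coset_of (cpow_N H r.+1),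
  coordinates (cpow H r.+1) phi /\ forall (i : 'I_r.+1) h u v w a b c, h \in H ->
    f h = Heis u v w a b c ->
    coordg H r.+1 i h = phi (Heis (u 0 0 *: delta_mx 0%R i) (v 0 0 *: delta_mx 0%R i)
      (w 0 0 *: delta_mx 0%R i) a b c)%R.
Proof.
have finvP (m : M) : exists h, (h \in H) && (f h == m).
  have : m \in f @* H by rewrite f_surj inE.
  by case/morphimP=> h Hh _ ->; exists h; rewrite Hh eqxx.
pose finv m := xchoose (finvP m).
have finvH m : finv m \in H by have /andP[] := xchooseP (finvP m).
have finvK m : f (finv m) = m by have /andP[_ /eqP] := xchooseP (finvP m).
(* A section of [psi]: the whole central part is placed in coordinate 0, so that the sums return it
   once. *)
pose g (q : heis F r.+1) : gTn := let: Heis u v w a b c := q in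
  [ffun i => finv (Heis (u 0 i)%:M (v 0 i)%:M (w 0 i)%:M
     (if i == ord0 then a else 0) (if i == ord0 then b else 0) (if i == ord0 then c else 0))%R].
have gH q : g q \in cpow_full H r.+1.
  by case: q => u v w a b c; apply/setXnP=> i; rewrite ffunE.
have psi_g q : psi (g q) = q.
  have sum (a : F) : (\sum_(i < r.+1) (if i == ord0 then a else 0) = a)%R.
    by rewrite -big_mkcond big_pred1_eq.
  case: q => u v w a b c; rewrite /psi; apply: eq_Heis.
  1-3: by apply/rowP=> i; rewrite mxE ffunE finvK /= mxE mulr1n.
  1-3: by rewrite -[RHS]sum; apply: eq_bigr => i _; rewrite ffunE finvK.
have full_norm t : t \in cpow_full H r.+1 -> t \in 'N(cpow_N H r.+1).
  exact: (subsetP N_norm).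
have cosetP t t' : t \in cpow_full H r.+1 -> t' \in cpow_full H r.+1 ->
    psi t = psi t' <-> coset (cpow_N H r.+1) t = coset (cpow_N H r.+1) t'.
  move=> Ht Ht'; have Hd : t * t'^-1 \in cpow_full H r.+1 by rewrite groupM ?groupV.
  have tE : t = (t * t'^-1) * t' by rewrite mulgKV.
  split=> [E|/rcoset_kercosetP].
    rewrite tE coset_morphM ?full_norm // (ker_psi Hd) ?mul1g //.
    by apply: (mulIg (psi t')); rewrite -psiM // -tE mul1g.
  rewrite mem_rcoset => /(_ (full_norm _ Ht) (full_norm _ Ht'))/psi_ker[_ E].
  by rewrite tE psiM // E mul1g.
pose phi q := coset (cpow_N H r.+1) (g q).
have phiE t : t \in cpow_full H r.+1 -> coset (cpow_N H r.+1) t = phi (psi t).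
  by move=> Ht; apply/cosetP; rewrite ?psi_g.
exists phi; split; last first.
  move=> i h u v w a b c Hh fh; rewrite /coordg (insubT (fun k => k < r.+1)) ?ltn_ord //= => lt_i.
  have -> : Sub (nat_of_ord i) lt_i = i by apply: val_inj.
  by rewrite phiE ?dg_full // psi_dg fh.
split.
- move=> q q'; rewrite /phi -morphM ?full_norm //; apply/cosetP; rewrite ?groupM //.
  by rewrite psiM // !psi_g.
- by move=> q q' /cosetP; rewrite !psi_g; apply.
apply/setP=> t; apply/imsetP/morphimP => [[q _ ->]|[s Ns Hs ->]].
  by exists (g q) => //; apply: full_norm.
by exists (psi s) => //; apply: phiE.
Qed.

End CentralPowerCoordinates.

(** * The standard decompositions and the orbits *)

Section Orbits.
Variable T : finGroupType.
Implicit Types (a b : {perm T}) (D : {set {set T}}).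

Lemma act_decomp1 D : act_decomp 1 D = D.
Proof.
rewrite /act_decomp -[RHS]imset_id; apply: eq_imset => K.
by rewrite -[RHS]imset_id; apply: eq_imset => t; rewrite perm1.
Qed.

Lemma act_decompM a b D : act_decomp (a * b) D = act_decomp b (act_decomp a D).
Proof.
rewrite /act_decomp -imset_comp; apply: eq_imset => K /=.
by rewrite -imset_comp; apply: eq_imset => t; rewrite permM.
Qed.

Lemma n_fr_orbits_transversal (A : {group {perm T}}) (G : {set T}) N
    (E : 'I_N -> {set {set T}}) :
  (forall i, fully_refined G (E i)) ->
  (forall D, fully_refined G D -> exists i, exists2 a, a \in A & act_decomp a D = E i) ->
  (forall i j a, a \in A -> act_decomp a (E i) = E j -> i = j) ->
  n_fr_orbits A G = N.
Proof.
move=> frE exE injE; pose orb D := [set act_decomp a D | a in A].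
have orb_refl D : D \in orb D.
  by apply/imsetP; exists 1; rewrite ?group1 ?act_decomp1.
have orb_act a D : a \in A -> orb (act_decomp a D) = orb D.
  move=> Aa; apply/setP=> D'; apply/imsetP/imsetP => [[b Ab ->]|[b Ab ->]].
    by exists (a * b); rewrite ?groupM ?act_decompM.
  by exists (a^-1 * b); rewrite ?groupM ?groupV // -act_decompM mulKVg.
rewrite /n_fr_orbits -[RHS]card_ord -cardsT -(@card_imset _ _ (fun i => orb (E i))).
  congr #|pred_of_set _|; apply/setP=> O; apply/imsetP/imsetP => [[D]|[i _ ->]].
    rewrite inE => /exE[i [a Aa aD]] ->; exists i => //.
    by rewrite -aD orb_act.
  by exists (E i); rewrite // inE.
move=> i j Eij; have := orb_refl (E j); rewrite -Eij => /imsetP[a Aa Ea].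
exact: injE Aa (esym Ea).
Qed.

Lemma autC'_group (G : {group T}) : group_set (autC' G).
Proof.
apply/group_setP; split.
  apply/setIdP; split; first exact: group1.
  by apply/forallP=> u; apply/implyP=> _; rewrite perm1.
move=> a b /setIdP[Aa /forallP fa] /setIdP[Ab /forallP fb].
apply/setIdP; split; first exact: groupM.
apply/forallP=> u; apply/implyP=> Gu; rewrite permM.
by have /eqP -> := implyP (fa u) Gu; apply: (implyP (fb u)).
Qed.

End Orbits.

Section Swap.
Variables (F : finFieldType) (r : nat) (T : finGroupType).
Variables (omega : F) (G : {set T}) (phi : heis F r -> T).
Hypothesis co : coordinates G phi.
Hypothesis omega0 : (omega != 0)%R.

(** The similitude turns norm 1 into [omega] and norm [omega] into omega^2, which scaling the vector
    by omega^-1 brings back to 1 without changing its line. *)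
Lemma lines_swap k (B S : 'M[F]_r) : k <= r ->
  (B *m B^T = gram r omega k)%R -> (S *m S^T = omega%:M)%R ->
  exists2 a, a \in Aut G & exists2 B' : 'M[F]_r,
    (B' *m B'^T = gram r omega (r - k))%R & act_decomp a (lines phi B) = lines phi B'.
Proof.
move=> le_kr E SS; have [a Aa aE] := similitude_aut co omega0 SS.
have xx i := gram_factor_neq0 i omega0 E.
exists a => //; pose c (i : 'I_r) : F := if (i < k)%N then (omega^-1)%R else 1%R.
have c0 i : c i != 0%R by rewrite /c; case: ifP; rewrite ?invr_eq0 // oner_neq0.
have rowS i : row i (B *m S)%R = (row i B *m S)%R by rewrite row_mul.
(* Reversing the order moves the vectors that now have norm [omega] to the front, as [gram]
   requires. *)
pose B' := (\matrix_i (c (rev_ord i) *: row (rev_ord i) (B *m S)))%R.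
exists B'.
  apply/matrixP=> i j; rewrite gramE -dot_row !rowK !rowS !dot_lin.
  rewrite (dot_mul _ _ SS) dot_row E gramE (inj_eq rev_ord_inj).
  case: eqVneq => [->|_]; last by rewrite !mulr0.
  rewrite /c /=.
  have -> : (r - j.+1 < k)%N = ~~ (j < r - k)%N by have := ltn_ord j; lia.
  by case: (j < r - k)%N => /=; field.
rewrite (act_lines omega0 SS aE xx).
apply/setP=> K; apply/imsetP/imsetP => -[i _ ->].
  exists (rev_ord i) => //; rewrite rowK rev_ordK; apply/esym.
  by apply: (line_scale _ (c0 i)); rewrite rowS (dot_mul _ _ SS) mulf_neq0.
exists (rev_ord i) => //; rewrite rowK.
by apply: (line_scale _ (c0 _)); rewrite rowS (dot_mul _ _ SS) mulf_neq0.
Qed.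

End Swap.

(** * The orthogonal bases behind the standard decompositions *)

Section StandardDecomp.
Local Open Scope ring_scope.
Variables (F : fieldType) (n : nat) (al be : F).
Local Notation r := n.*2.

Definition evec k : 'rV[F]_r := \row_j (j == k :> nat)%:R.

Lemma dot_evec k l : (k < r)%N -> dot (evec k) (evec l) = (k == l)%:R.
Proof.
move=> lt_k; have -> : evec k = delta_mx 0 (Ordinal lt_k).
  by apply/rowP=> j; rewrite !mxE.
by rewrite dotC dot_delta mxE.
Qed.

(** Indices start at 0, so below 2m an even [k] opens a pair and gives [Kodd], while an odd [k]
    closes it and gives [Keven]. *)
Definition hm_vec m k : 'rV[F]_r :=
  if (k < m.*2)%N then
    if odd k then be *: evec k.-1 - al *: evec k else al *: evec k + be *: evec k.+1
  else evec k.

Definition hm_mx m : 'M[F]_r := \matrix_(i < r) hm_vec m i.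

Variant hm_index_spec m : nat -> Prop :=
  | HmEven a of (a < m)%N : hm_index_spec m a.*2
  | HmOdd a of (a < m)%N : hm_index_spec m a.*2.+1
  | HmRest k of (m.*2 <= k)%N : hm_index_spec m k.

Lemma hm_indexP m k : hm_index_spec m k.
Proof.
have [lt_k|] := ltnP k m.*2; last exact: HmRest.
rewrite -(odd_double_half k); case: (odd k); [apply: HmOdd | apply: HmEven]; lia.
Qed.

Lemma hm_vec_even m a : (a < m)%N ->
  hm_vec m a.*2 = al *: evec a.*2 + be *: evec a.*2.+1.
Proof. by move=> lt_a; rewrite /hm_vec ltn_double lt_a odd_double. Qed.

Lemma hm_vec_odd m a : (a < m)%N ->
  hm_vec m a.*2.+1 = be *: evec a.*2 - al *: evec a.*2.+1.
Proof. by move=> lt_a; rewrite /hm_vec ltn_Sdouble lt_a /= odd_double. Qed.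

Lemma hm_vec_rest m k : (m.*2 <= k)%N -> hm_vec m k = evec k.
Proof. by move=> le_k; rewrite /hm_vec ltnNge le_k. Qed.

Lemma hm_mx_gram m : (m <= n)%N ->
  hm_mx m *m (hm_mx m)^T = gram r (al ^+ 2 + be ^+ 2) m.*2.
Proof.
move=> le_mn; apply/matrixP=> i j; rewrite gramE -dot_row !rowK -val_eqE /=.
have := ltn_ord i; have := ltn_ord j; move: (val i) (val j) => {i j} k l.
case: (hm_indexP m k) => [a lt_a|a lt_a|{}k le_k];
  case: (hm_indexP m l) => [b lt_b|b lt_b|{}l le_l] lt_l lt_k;
  rewrite ?(hm_vec_even, hm_vec_odd, hm_vec_rest) // ?dot_lin !dot_evec //; try lia;
  rewrite ?eqSS ?eqn_double ?ltn_double ?ltn_Sdouble.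
- have -> : (a.*2 == b.*2.+1) = false by lia.
  have -> : (a.*2.+1 == b.*2) = false by lia.
  by rewrite lt_a; case: eqP => _ /=; ring.
- have -> : (a.*2 == b.*2.+1) = false by lia.
  have -> : (a.*2.+1 == b.*2) = false by lia.
  by case: eqP => _ /=; ring.
- have -> : (a.*2 == l) = false by lia.
  have -> : (a.*2.+1 == l) = false by lia.
  by rewrite /=; ring.
- have -> : (a.*2 == b.*2.+1) = false by lia.
  have -> : (a.*2.+1 == b.*2) = false by lia.
  by case: eqP => _ /=; ring.
- have -> : (a.*2 == b.*2.+1) = false by lia.
  have -> : (a.*2.+1 == b.*2) = false by lia.
  by rewrite lt_a; case: eqP => _ /=; ring.
- have -> : (a.*2 == l) = false by lia.
  have -> : (a.*2.+1 == l) = false by lia.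
  by rewrite /=; ring.
- have -> : (k == b.*2) = false by lia.
  have -> : (k == b.*2.+1) = false by lia.
  by rewrite /=; ring.
- have -> : (k == b.*2) = false by lia.
  have -> : (k == b.*2.+1) = false by lia.
  by rewrite /=; ring.
- by rewrite ltnNge le_k; case: eqP.
Qed.

End StandardDecomp.

Lemma cpow_heis (p : nat) (gT : finGroupType) (H : {group gT}) (x y z : gT) r :
  prime p -> odd p -> free_class2_exp p H x y z -> 0 < r ->
  exists phi : heis 'F_p r -> coset_of (cpow_N H r), coordinates (cpow H r) phi /\
    forall k : nat, k < r -> let v := (\row_j (j == k :> nat)%:R)%R in
    [/\ coordg H r k x = phi (Heis v 0 0 0 0 0), coordg H r k y = phi (Heis 0 v 0 0 0 0)
      & coordg H r k z = phi (Heis 0 0 v 0 0 0)].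
Proof.
move=> p_pr p_odd freeH; case: r => // r _.
have [f [f_inj f_surj fx fy fz]] := free_heis p_pr p_odd freeH.
have [phi [co cg]] := cpow_coordinates r p_pr p_odd f_inj f_surj.
have [defH _ _] := freeH.
have [Hx Hy Hz] : [/\ x \in H, y \in H & z \in H].
  by rewrite defH !mem_gen // !inE eqxx ?orbT.
exists phi; split=> // k lt_k /=.
have -> : (\row_(j < r.+1) (j == k :> nat)%:R = delta_mx 0 (Ordinal lt_k) :> 'rV['F_p]_r.+1)%R.
  by apply/rowP=> j; rewrite !mxE.
have := cg (Ordinal lt_k) _ _ _ _ _ _ _ Hx fx; have := cg (Ordinal lt_k) _ _ _ _ _ _ _ Hy fy.
have := cg (Ordinal lt_k) _ _ _ _ _ _ _ Hz fz.
by rewrite !mxE !scale0r !scale1r.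
Qed.

Section StandardLines.
Variables (p : nat) (gT : finGroupType) (H : {group gT}) (x y z : gT).
Variables (n : nat) (al be : 'F_p).
Hypotheses (p_pr : prime p) (p_odd : odd p).
Local Notation r := n.*2.
Variable phi : heis 'F_p r -> coset_of (cpow_N H r).
Hypothesis co : coordinates (cpow H r) phi.
Local Notation e := (@evec 'F_p n).
Hypothesis cg : forall k : nat, k < r ->
  [/\ coordg H r k x = phi (Heis (e k) 0 0 0 0 0), coordg H r k y = phi (Heis 0 (e k) 0 0 0 0)
    & coordg H r k z = phi (Heis 0 0 (e k) 0 0 0)].
Hypothesis nsq : (forall u : 'F_p, u ^+ 2 != al ^+ 2 + be ^+ 2)%R.
Let F_odd := odd_prime_field_Fp p_pr p_odd.
Let omega0 : (al ^+ 2 + be ^+ 2 != 0)%R.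
Proof. by apply: contraNneq (nsq 0%R) => ->; rewrite expr0n. Qed.

Lemma gen_image_line (f : gT -> coset_of (cpow_N H r)) v : dot v v != 0%R ->
  [/\ f x = phi (Heis v 0 0 0 0 0), f y = phi (Heis 0 v 0 0 0 0)
    & f z = phi (Heis 0 0 v 0 0 0)] ->
  <<[set f g | g in [set x; y; z]]>> = line phi v.
Proof. by move=> vv [fx fy fz]; rewrite !imsetU !imset_set1 fx fy fz (line_gen F_odd co). Qed.

Lemma phi_lin (u v : 'rV['F_p]_r) (a b : 'F_p) :
  [/\ phi (Heis u 0 0 0 0 0) ^+ val a * phi (Heis v 0 0 0 0 0) ^+ val b
        = phi (Heis (a *: u + b *: v) 0 0 0 0 0),
      phi (Heis 0 u 0 0 0 0) ^+ val a * phi (Heis 0 v 0 0 0 0) ^+ val b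
        = phi (Heis 0 (a *: u + b *: v) 0 0 0 0)
    & phi (Heis 0 0 u 0 0 0) ^+ val a * phi (Heis 0 0 v 0 0 0) ^+ val b
        = phi (Heis 0 0 (a *: u + b *: v) 0 0 0)].
Proof.
have natr (c : 'F_p) : ((val c)%:R = c)%R by apply: natr_Zp.
have [phiM _ _] := co.
by split; rewrite -!(coordX _ _ co) -phiM !heis_expE // !natr heis_mulE
  !(dot_lin, scaler0, mulr0, subr0, addr0).
Qed.

Lemma phi_linV (u v : 'rV['F_p]_r) (a b : 'F_p) :
  [/\ phi (Heis u 0 0 0 0 0) ^+ val a * (phi (Heis v 0 0 0 0 0) ^+ val b)^-1
        = phi (Heis (a *: u - b *: v) 0 0 0 0 0),
      phi (Heis 0 u 0 0 0 0) ^+ val a * (phi (Heis 0 v 0 0 0 0) ^+ val b)^-1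
        = phi (Heis 0 (a *: u - b *: v) 0 0 0 0)
    & phi (Heis 0 0 u 0 0 0) ^+ val a * (phi (Heis 0 0 v 0 0 0) ^+ val b)^-1
        = phi (Heis 0 0 (a *: u - b *: v) 0 0 0)].
Proof.
have [phiM _ _] := co.
(* The inverse is avoided by adding b v back to a u - b v and solving the resulting equation. *)
have [e1 e2 e3] := phi_lin (a *: u - b *: v)%R v 1%R b.
have [l1 l2 l3] := phi_lin u v a 0%R.
have val1 : val (1%R : 'F_p) = 1%N by rewrite /= modn_small.
have val0 : val (0%R : 'F_p) = 0%N by [].
move: e1 e2 e3 l1 l2 l3; rewrite val1 val0 !expg1 !expg0 !mulg1 !scale1r !subrK !scale0r !addr0.
by move=> e1 e2 e3 -> -> ->; split; apply/(canLR (mulgK _)).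
Qed.

(** The three generators of each member are the copies of one anisotropic vector in the three slots,
    and these generate its line. *)
Lemma Hm_lines m : m <= n -> Hm H x y z n al be m = lines phi (hm_mx n al be m).
Proof.
move=> le_mn; have gramE := hm_mx_gram al be le_mn.
have vv k : k < r -> dot (hm_vec n al be m k) (hm_vec n al be m k) != 0%R.
  by move=> lt_k; have := gram_factor_neq0 (Ordinal lt_k) omega0 gramE; rewrite rowK.
have lineK k : k < r -> line phi (hm_vec n al be m k) \in lines phi (hm_mx n al be m).
  by move=> lt_k; apply/imsetP; exists (Ordinal lt_k); rewrite ?rowK.
have oddE j : j < m -> Kodd H x y z n al be j = line phi (hm_vec n al be m j.*2).
  move=> lt_j; apply: gen_image_line; first by apply: vv; lia.
  have [|x1 y1 z1] := cg (k := j.*2); first by lia.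
  have [|x2 y2 z2] := cg (k := j.*2.+1); first by lia.
  rewrite x1 y1 z1 x2 y2 z2 hm_vec_even //; exact: phi_lin.
have evenE j : j < m -> Keven H x y z n al be j = line phi (hm_vec n al be m j.*2.+1).
  move=> lt_j; apply: gen_image_line; first by apply: vv; lia.
  have [|x1 y1 z1] := cg (k := j.*2); first by lia.
  have [|x2 y2 z2] := cg (k := j.*2.+1); first by lia.
  rewrite x1 y1 z1 x2 y2 z2 hm_vec_odd //; exact: phi_linV.
have restE k : m.*2 <= k -> k < r -> Hcoord H x y z n k = line phi (hm_vec n al be m k).
  move=> le_k lt_k; apply: gen_image_line; first exact: vv.
  by rewrite hm_vec_rest //; apply: cg.
apply/setP=> K; apply/idP/idP.
  rewrite !inE => /orP[/orP[]|] /imsetP[j].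
  - by move=> _ ->; rewrite oddE //; apply: lineK; have := ltn_ord j; lia.
  - by move=> _ ->; rewrite evenE //; apply: lineK; have := ltn_ord j; lia.
  - by rewrite inE => le_j ->; rewrite restE //; apply: lineK.
case/imsetP=> i _ ->; rewrite rowK !inE.
have := ltn_ord i; move: (nat_of_ord i) => {i} k lt_k.
case: (hm_indexP m k) lt_k => [a lt_a|a lt_a|{}k le_k] lt_k.
- by apply/orP; left; apply/orP; left; apply/imsetP; exists (Ordinal lt_a); rewrite ?oddE.
- by apply/orP; left; apply/orP; right; apply/imsetP; exists (Ordinal lt_a); rewrite ?evenE.
by apply/orP; right; apply/imsetP; exists (Ordinal lt_k); rewrite ?inE ?restE.
Qed.

End StandardLines.

Lemma line_isog (F : finFieldType) r (T : finGroupType) (G : {set T})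
    (phi : heis F r -> T) v : coordinates G phi -> dot v v != 0%R ->
  [set: heis F 1] \isog line phi v.
Proof.
move=> co vv; have [gM gI <-] := line_coordinates co vv.
pose g := Morphism (D := [set: heis F 1]) (in2W gM).
have -> : (phi \o line_coord v) @: setT = g @* setT by rewrite morphimEdom.
by apply: sub_isog => //; apply/injmP=> s t _ _ /gI.
Qed.

Theorem theorem7p10 (p : nat) (gT : finGroupType) (H : {group gT}) (x y z : gT)
    (n : nat) (al be : 'F_p) :
  prime p -> odd p ->
  free_class2_exp p H x y z ->
  0 < n ->
  ~~ [exists u : 'F_p, (u ^+ 2 == al ^+ 2 + be ^+ 2)%R] ->
  [/\
   (* (i) *)
   (forall m, m <= n -> forall K, K \in Hm H x y z n al be m -> K \isog H),
   (* (ii) *)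
   (forall m, m <= n -> fully_refined (cpow H n.*2) (Hm H x y z n al be m)),
   (* (iii) *)
   (forall D, fully_refined (cpow H n.*2) D ->
      exists! m, m <= n /\
        exists2 a, a \in autC' (cpow H n.*2) & act_decomp a D = Hm H x y z n al be m)
   /\ n_fr_orbits (autC' (cpow H n.*2)) (cpow H n.*2) = n.+1,
   (* (iv) *)
   (forall m m', m <= n -> m' <= n ->
      ((exists2 a, a \in Aut (cpow H n.*2) &
          act_decomp a (Hm H x y z n al be m) = Hm H x y z n al be m')
       <-> (m' = m \/ m' = n - m))) &
   (* conclusion *)
   n_fr_orbits (Aut (cpow H n.*2)) (cpow H n.*2) = 1 + n./2].
Proof.
move=> p_pr p_odd freeH n_gt0 /existsPn nsq.
have F_odd := odd_prime_field_Fp p_pr p_odd.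
have r_gt0 : 0 < n.*2 by rewrite double_gt0.
have [phi [co cg]] := cpow_heis p_pr p_odd freeH r_gt0.
set omega := (al ^+ 2 + be ^+ 2)%R in nsq.
have omega0 : (omega != 0)%R by apply: contraNneq (nsq 0%R) => ->; rewrite expr0n.
have omega_sq := square_class (proj1 F_odd) nsq.
have HmE m : m <= n -> Hm H x y z n al be m = lines phi (hm_mx n al be m).
  exact: (Hm_lines p_pr p_odd co cg nsq).
have gramB m : m <= n -> (hm_mx n al be m *m (hm_mx n al be m)^T = gram n.*2 omega m.*2)%R.
  exact: hm_mx_gram.
pose P := Group (coord_group co).
have gC := autC'_group P.
have frHm m : m <= n -> fully_refined (cpow H n.*2) (Hm H x y z n al be m).
  move=> le_mn; rewrite HmE //.
  exact: (lines_fully_refined F_odd r_gt0 omega0 co (gramB _ le_mn)).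
have exHm D : fully_refined (cpow H n.*2) D -> exists2 m, m <= n &
    exists2 a, a \in autC' (cpow H n.*2) & act_decomp a D = Hm H x y z n al be m.
  move=> frD.
  have [k [B [le_k E ->]]] := fully_refined_lines F_odd r_gt0 omega0 omega_sq co frD.
  (* The number of norms equal to [omega] is even, so it is 2m for some m, and the orthogonal group
     carries the basis to the standard one. *)
  have k_even := gram_factor_even nsq le_k E.
  have kE : k = k./2.*2 by rewrite -{1}(odd_double_half k) (negbTE k_even).
  have le_k2 : k./2 <= n by rewrite -leq_double -kE.
  exists k./2 => //; rewrite HmE //; rewrite kE in E.
  exact: (lines_conjugate F_odd co omega0 E (gramB _ le_k2)).
have inv a m m' : m <= n -> m' <= n -> a \in Aut (cpow H n.*2) ->
    act_decomp a (Hm H x y z n al be m) = Hm H x y z n al be m' ->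
    (m' = m \/ m' = n - m) /\ (a \in autC' (cpow H n.*2) -> m' = m).
  move=> le_m le_m' Aa; rewrite !HmE // => aE.
  have le2 : m.*2 <= n.*2 by rewrite leq_double.
  have le2' : m'.*2 <= n.*2 by rewrite leq_double.
  have [h hC] := lines_invariant F_odd r_gt0 nsq omega_sq co le2 le2'
    (gramB _ le_m) (gramB _ le_m') Aa aE.
  split=> [|/hC/double_inj //]; case: h => [/double_inj|]; first by left.
  by rewrite -doubleB => /double_inj; right.
have CA a : a \in autC' (cpow H n.*2) -> a \in Aut (cpow H n.*2).
  exact: (subsetP (sub_autC' _)).
have part4 m m' : m <= n -> m' <= n ->
    (exists2 a, a \in Aut (cpow H n.*2) &
      act_decomp a (Hm H x y z n al be m) = Hm H x y z n al be m')
    <-> (m' = m \/ m' = n - m).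
  move=> le_m le_m'; split=> [[a Aa aE]|[->|m'E]].
  - by have [] := inv a m m' le_m le_m' Aa aE.
  - by exists 1; rewrite ?act_decomp1 //; apply: (group1 (Aut_group P)).
  (* All rows of the matrix for m = n have norm [omega], so this matrix is itself a similitude of
     factor [omega]. *)
  have SS : (hm_mx n al be n *m (hm_mx n al be n)^T = omega%:M)%R.
    rewrite gramB //; apply/matrixP=> i j; rewrite gramE mxE ltn_ord.
    by case: eqP => _; rewrite ?mulr1n ?mulr0n.
  have [|a Aa [B' EB aE]] := lines_swap co omega0 _ (gramB _ le_m) SS.
    by rewrite leq_double.
  rewrite -doubleB -m'E in EB.
  have [b Cb bE] := lines_conjugate F_odd co omega0 EB (gramB _ le_m').
  exists (a * b); first by apply: (groupM (G := Aut_group P)) => //; apply: CA.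
  by rewrite act_decompM (HmE m) // aE bE HmE.
split=> //.
- move=> m le_m K; rewrite HmE // => /imsetP[i _ ->].
  have [f [f_inj f_surj _ _ _]] := free_heis p_pr p_odd freeH.
  have vv := gram_factor_neq0 i omega0 (gramB _ le_m).
  have isoM : H \isog [set: heis 'F_p 1] by rewrite -f_surj; apply: sub_isog.
  pose L := Group (coord_group (line_coordinates co vv)).
  have isoL : [set: heis 'F_p 1] \isog L := line_isog co vv.
  suff : L \isog H by [].
  by rewrite isog_sym; apply: isog_trans isoM isoL.
- split=> [D frD|].
    have [m le_m [a Ca aE]] := exHm D frD; exists m; split; first by split=> //; exists a.
    move=> m' [le_m' [b Cb bE]].
    (* This composite maps the decomposition for [m] to the one for [m'], and the invariant makes
       them equal. *)
    have Cab : a^-1 * b \in Group gC by rewrite groupM ?groupV.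
    have [] := inv (a^-1 * b) m m' le_m le_m' (CA _ Cab); last by move=> _ /(_ Cab).
    by rewrite -aE -act_decompM mulKVg.
  apply: (@n_fr_orbits_transversal _ (Group gC) _ _ (fun i : 'I_n.+1 => Hm H x y z n al be i)).
  + by move=> i; apply: frHm; rewrite -ltnS.
  + move=> D /exHm[m le_m ex]; exists (Ordinal (le_m : m < n.+1)); exact: ex.
  move=> i j a Ca aE; apply/val_inj/esym => /=.
  by have [_ ->] := inv a i j (ltnSE (ltn_ord i)) (ltnSE (ltn_ord j)) (CA _ Ca) aE.
(* The indices m up to n/2 represent all orbits: a larger m is exchanged with n - m, and two such
   indices with sum n are equal. *)
have half_le (i : 'I_(n./2).+1) : i <= n by have := ltn_ord i; lia.
apply: (@n_fr_orbits_transversal _ (Aut_group P) _ _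
  (fun i : 'I_(n./2).+1 => Hm H x y z n al be i)).
- by move=> i; apply: frHm.
- move=> D /exHm[m le_m [a Ca aE]]; case: (leqP m n./2) => le_m2.
    by exists (Ordinal (le_m2 : m < n./2.+1)); exists a => //; apply: CA.
  have le_nm : n - m < n./2.+1 by lia.
  have [b Ab bE] := (part4 m (n - m) le_m (leq_subr _ _)).2 (or_intror erefl).
  exists (Ordinal le_nm); exists (a * b); last by rewrite act_decompM aE bE.
  by apply: groupM => //; apply: CA.
move=> i j a Aa aE; apply/val_inj => /=.
have := ltn_ord i; have := ltn_ord j.
by have [[]] := inv a i j (half_le i) (half_le j) Aa aE; lia.
Qed.
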